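(* Let $(N,g)$ be a connected Riemannian manifold of dimension $n>1$, let $D$ be a field of symmetric endomorphisms on $(N,g)$ such that the $D$-extension $(M,g^D)$ is Einstein and $\det D\neq 0$, and let $\mathbf{p}=(p_1,\dots,p_n)^t$ be the spectral vector of $D$. (i) The orthogonal projection of $\mathbf{1}_n$ to $\mathbf{p}^\perp$ belongs to the convex cone hull of the set $F\cap\mathbf{p}^\perp$. (ii) If, in addition, $\operatorname{Tr} D\neq 0$, then up to scaling (that is, up to multiplication by a nonzero real constant), the spectral vector is given by $$\mathbf{p}=\mathbf{1}_n-V(V^tV)^{-1}\mathbf{1}_m .$$ In particular, up to scaling, all the $p_i$ are integers. Moreover, for every dimension $n$, there is, up to scaling, only a finite number of eigenvalue types (spectral vectors) of operators $D$ with $\det D\neq0$ and $\operatorname{Tr}D\neq0$ for which the $D$-extension of some $n$-dimensional connected Riemannian manifold is Einstein.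
   Context: Everything is smooth. $D$ is a smooth field of $g$-symmetric endomorphisms of $TN$. For $u\in\mathbb{R}$, $g^u(X,Y)=g(e^{uD}X,e^{uD}Y)$; the $D$-extension is $(M:=\mathbb{R}\times N,\ g^D:=du^2+g^u)$. Einstein means that the Ricci tensor is a constant times the metric. If $(M,g^D)$ is Einstein, then the eigenvalues of $D$ are constant on $N$; the spectral vector (eigenvalue type) of $D$ is the vector $\mathbf{p}=(p_1,\dots,p_n)^t$ of its eigenvalues, listed with multiplicity. In the Euclidean space $\mathbb{R}^n$ with an orthonormal basis $f_1,\dots,f_n$, let $F=\{f_i+f_j-f_k : i\neq j,\ k\neq i,j\}$, and let $\mathbf{1}_r=(1,\dots,1)^t$ ($r$ ones). Let $F_{\mathbf{p}}=\{v_1,\dots,v_m\}$ be a maximal linearly independent subset of the finite set $F\cap\mathbf{p}^\perp$ (any of them, if there is more than one), and let $V$ be the $n\times m$ matrix whose columns are the vectors $v_1,\dots,v_m$ (written in coordinates with respect to $f_1,\dots,f_n$). The convex cone hull of a set is the set of all linear combinations of its elements with nonnegative coefficients (equal to $\{0\}$ for the empty set); if $m=0$, the term $V(V^tV)^{-1}\mathbf{1}_m$ is understood to be $0$. *)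

(* Defs.v *)
(* MathComp-Analysis; the real numbers are an arbitrary R : realType.         *)
(*                                                                            *)
(* Points and tangent vectors are row vectors of components in a chart, so    *)
(* that linear maps act by right multiplication, as in the library's          *)
(* Jacobian: 'D_v f a = v *m 'J f a.  Accordingly, in a chart, a field of     *)
(* endomorphisms is a matrix D with X |-> X *m D, and a field of bilinear     *)
(* forms is a matrix g with g(X, Y) = X *m g *m Y^T.                          *)
(* Vectors of the auxiliary Euclidean space R^n are columns.                  *)
From HB Require Import structures.
From mathcomp Require Import all_boot all_order all_algebra.
From mathcomp Require Import all_classical all_reals all_analysis.

Set Implicit Arguments.
Unset Strict Implicit.
Unset Printing Implicit Defensive.

Import Order.TTheory GRing.Theory Num.Theory.
Import numFieldNormedType.Exports.

Local Open Scope classical_set_scope.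
Local Open Scope ring_scope.

Section Smoothness.
Variables (R : realType) (n : nat).

Definition pderive (i : 'I_n) (f : 'rV[R]_n -> R) : 'rV[R]_n -> R :=
  'D_('e_i) f.

(* C^oo on U (meant for U open): every iterated partial derivative of f is    *)
(* differentiable at every point of U.                                        *)
Definition smooth_on (U : set 'rV[R]_n) (f : 'rV[R]_n -> R) : Prop :=
  forall (s : seq 'I_n) (x : 'rV[R]_n), U x ->
    differentiable (foldr pderive f s) x.

Definition smooth_mx_on (m p : nat) (U : set 'rV[R]_n)
    (f : 'rV[R]_n -> 'M[R]_(m, p)) : Prop :=
  forall i j, smooth_on U (fun x => f x i j).

End Smoothness.

Section Manifold.
Variables (R : realType).

Record chart (T : topologicalType) (n : nat) := Chart {
  dom : set T ;
  coord : T -> 'rV[R]_n ;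
  param : 'rV[R]_n -> T }.

Definition cimage (T : topologicalType) (n : nat) (c : chart T n) : set 'rV[R]_n :=
  coord c @` dom c.

Definition is_chart (T : topologicalType) (n : nat) (c : chart T n) : Prop :=
  [/\ open (dom c), open (cimage c),
      (forall x, dom c x -> param c (coord c x) = x),
      {within dom c, continuous (coord c)} &
      {within cimage c, continuous (param c)}].

Definition overlap (T : topologicalType) (n : nat) (c d : chart T n) : set 'rV[R]_n :=
  coord c @` (dom c `&` dom d).

Definition transition (T : topologicalType) (n : nat) (c d : chart T n) :
    'rV[R]_n -> 'rV[R]_n := coord d \o param c.

(* The data of a Riemannian manifold of dimension n: an atlas (not            *)
(* necessarily maximal) and the components of the metric in each chart.       *)
(* The axioms are in is_riemannian_manifold.                                  *)
Record riemannian_data (n : nat) := RiemannianData {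
  carrier :> topologicalType ;
  chart_index : Type ;
  atlas : chart_index -> chart carrier n ;
  metric : chart_index -> 'rV[R]_n -> 'M[R]_n }.

Definition is_smooth_atlas (n : nat) (T : topologicalType) (I : Type)
    (A : I -> chart T n) : Prop :=
  [/\ forall i, is_chart (A i),
      forall x, exists i, dom (A i) x &
      forall i j, smooth_mx_on (overlap (A i) (A j)) (transition (A i) (A j))].

Definition is_riemannian_manifold (n : nat) (N : riemannian_data n) : Prop :=
  [/\ hausdorff_space N,
      @second_countable N,
      is_smooth_atlas (@atlas n N) &
      [/\ forall i, smooth_mx_on (cimage (atlas i)) (@metric n N i),
          forall i j y, overlap (atlas i) (atlas j) y ->
            let t := transition (atlas i) (atlas j) in
            @metric n N i y = jacobian t y *m @metric n N j (t y) *m (jacobian t y)^T,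
          forall i y, cimage (atlas i) y -> (@metric n N i y)^T = metric i y &
          forall i y, cimage (atlas i) y -> forall v : 'rV[R]_n, v != 0 ->
            0 < (v *m @metric n N i y *m v^T) 0 0]].

Definition is_connected (n : nat) (N : riemannian_data n) : Prop :=
  [set: N] !=set0 /\ connected [set: N].

(* D i y is the matrix, in the chart i, of an endomorphism of the tangent     *)
(* space at the point of coordinates y; D *m g = g *m D^T says that           *)
(* g(DX, Y) = g(X, DY).                                                       *)
Definition is_symmetric_endo_field (n : nat) (N : riemannian_data n)
    (D : chart_index N -> 'rV[R]_n -> 'M[R]_n) : Prop :=
  [/\ forall i, smooth_mx_on (cimage (atlas i)) (D i),
      forall i j y, overlap (atlas i) (atlas j) y ->
        let t := transition (atlas i) (atlas j) in
        D i y *m jacobian t y = jacobian t y *m D j (t y) &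
      forall i y, cimage (atlas i) y -> D i y *m metric i y = metric i y *m (D i y)^T].

End Manifold.

Section Curvature.
Variables (R : realType) (n : nat).
Implicit Types (g : 'rV[R]_n -> 'M[R]_n) (y : 'rV[R]_n).

(* Christoffel symbols (upper index k, lower indices i and j) of the          *)
(* Levi-Civita connection.                                                    *)
Definition christoffel g (k i j : 'I_n) y : R :=
  2^-1 * \sum_(l < n) (invmx (g y)) k l *
    (pderive i (fun z => g z j l) y + pderive j (fun z => g z i l) y
     - pderive l (fun z => g z i j) y).

Definition ricci g y : 'M[R]_n := \matrix_(i, j)
  \sum_(k < n) (pderive k (christoffel g k i j) y - pderive j (christoffel g k i k) y
    + \sum_(l < n) (christoffel g k k l y * christoffel g l i j y
                    - christoffel g k j l y * christoffel g l i k y)).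

Definition is_einstein (N : riemannian_data R n) : Prop :=
  exists c : R, forall (i : chart_index N) y, cimage (atlas i) y ->
    ricci (@metric R n N i) y = c *: metric i y.

End Curvature.

Section Extension.
Variables (R : realType) (n : nat).

Definition expmx (A : 'M[R]_n) : 'M[R]_n :=
  limn (series (fun k : nat => (k`!%:R : R)^-1 *: A ^+ k)).

Definition product_chart (T : topologicalType) (c : chart R T n) :
    chart R (R * T)%type (1 + n) :=
  Chart (setT `*` dom c)
        (fun z => row_mx (z.1)%:M (coord c z.2))
        (fun v => (lsubmx v 0 0, param c (rsubmx v))).

Definition g_u (N : riemannian_data R n) (D : chart_index N -> 'rV[R]_n -> 'M[R]_n)
    (u : R) (i : chart_index N) (y : 'rV[R]_n) : 'M[R]_n :=
  expmx (u *: D i y) *m metric i y *m (expmx (u *: D i y))^T.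

(* The manifold R x N with the metric du^2 + g^u.                             *)
Definition D_extension (N : riemannian_data R n)
    (D : chart_index N -> 'rV[R]_n -> 'M[R]_n) : riemannian_data R (1 + n) :=
  @RiemannianData R (1 + n) (R * N)%type (chart_index N)
    (fun i => product_chart (atlas i))
    (fun i v => block_mx 1%:M 0 0 (g_u D (lsubmx v 0 0) i (rsubmx v))).

(* p lists the eigenvalues of D, with multiplicity; D has the same            *)
(* eigenvalues at all the points of N.                                        *)
Definition is_spectral_vector (N : riemannian_data R n)
    (D : chart_index N -> 'rV[R]_n -> 'M[R]_n) (p : 'cV[R]_n) : Prop :=
  forall i y, cimage (atlas i) y ->
    char_poly (D i y) = \prod_(k < n) ('X - (p k 0)%:P).

Definition det_nonzero (N : riemannian_data R n)
    (D : chart_index N -> 'rV[R]_n -> 'M[R]_n) : Prop :=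
  forall i y, cimage (atlas i) y -> \det (D i y) != 0.

Definition trace_nonzero (N : riemannian_data R n)
    (D : chart_index N -> 'rV[R]_n -> 'M[R]_n) : Prop :=
  forall i y, cimage (atlas i) y -> \tr (D i y) != 0.

End Extension.

Section Euclidean.
Variables (R : realType) (n : nat).
Implicit Types (p v w : 'cV[R]_n) (S : set 'cV[R]_n).

Definition dot v w : R := (v^T *m w) 0 0.

Definition perp p : set 'cV[R]_n := [set v | dot v p = 0].

(* w is the orthogonal projection of v to the linear subspace S.              *)
Definition is_orthogonal_projection S v w : Prop :=
  S w /\ forall z, S z -> dot (v - w) z = 0.

Definition fvec (i : 'I_n) : 'cV[R]_n := delta_mx i 0.

Definition Fset : set 'cV[R]_n :=
  [set v | exists i j k : 'I_n,
     [/\ i != j, k != i, k != j & v = fvec i + fvec j - fvec k]].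

Definition cone_hull S : set 'cV[R]_n :=
  [set v | exists (m : nat) (s : 'I_m -> 'cV[R]_n) (a : 'I_m -> R),
     [/\ forall l, S (s l), forall l, 0 <= a l & v = \sum_(l < m) a l *: s l]].

Definition independent_columns_in S (m : nat) (V : 'M[R]_(n, m)) : Prop :=
  (forall j, S (col j V)) /\ row_free V^T.

(* The columns of V are pairwise distinct and form a linearly independent     *)
(* subset of S which is maximal for inclusion.                                *)
Definition maximal_independent_columns_in S (m : nat) (V : 'M[R]_(n, m)) : Prop :=
  independent_columns_in S V /\
  forall (m' : nat) (V' : 'M[R]_(n, m')), independent_columns_in S V' ->
    [set col j V | j in [set: 'I_m]] `<=` [set col j V' | j in [set: 'I_m']] ->
    [set col j V' | j in [set: 'I_m']] = [set col j V | j in [set: 'I_m]].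

Definition ones (r : nat) : 'cV[R]_r := const_mx 1.

End Euclidean.

(* Main.v *)
(* Near a point of N choose a g-orthonormal frame E_1, ..., E_n of eigenvector  *)
(* fields of D with dual coframe th; it is orthogonal for every g^u, with       *)
(* g^u(E_a, E_a) = e^(2 u p_a).  The Koszul formula expresses the Ricci tensor  *)
(* of du^2 + g^u through t_abk = d(th_k)(E_a, E_b).  The component along d_u is *)
(* - sum p_a^2, hence this is the Einstein constant, and the (E_q, E_q)         *)
(* component divided by e^(2 u p_q) is an identity between exponential          *)
(* polynomials in u.  Every frequency occurring in it is either some - 2 p_a,   *)
(* which is nonzero because det D != 0, or 2 (p_k - p_i - p_j), with            *)
(* coefficient a multiple of a square t_ijk^2.  Comparing constant terms gives  *)
(*   |p|^2 1_n - (Tr D) p = sum_(p_k = p_i + p_j) t_ijk^2 / 4 (f_i + f_j - f_k) *)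
(* in R^n, from which both parts follow by linear algebra: vectors of F have    *)
(* coordinate sum 1, and F is finite with integral coordinates.                 *)
Require Import Defs.
From HB Require Import structures.
From mathcomp Require Import all_boot all_order all_algebra.
From mathcomp Require Import all_classical all_reals all_analysis.
From mathcomp Require Import fingroup perm ring lra.
Import Order.TTheory GRing.Theory Num.Theory.
Import numFieldNormedType.Exports.
Local Open Scope classical_set_scope.
Local Open Scope ring_scope.

Set Implicit Arguments.
Unset Strict Implicit.
Unset Printing Implicit Defensive.

(** * Directional derivatives of matrix-valued maps *)

(** Everything rests on one identity in R^n: with [s] = |p|^2 and [T] = Tr D, the vector s 1_n - T p
    is a combination, with nonnegative coefficients, of vectors f_i + f_j - f_k lying in F and
    orthogonal to p. [einstein_extension_resonance] packages it.

    The geometric half computes Ricci curvature in a moving frame. [local_eigenframe] provides a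
    g-orthonormal frame of eigenvectors of D. [christoffel_unique] and [curvature_gauge] turn the
    coordinate definition of [ricci] into the frame formula [ricci_frame]. For du^2 + g^u this gives
    [ricci_extension_l] and [ricci_extension_r], in which the parameter u enters only through the
    weights e^(2 u p_a). The first one fixes the Einstein constant as -|p|^2. In the second one the
    point of N is kept fixed and u varies, so the Einstein equation is an identity between
    exponential polynomials, and distinct exponentials are independent ([has_mean_cst]). Its
    constant term ([weight_zero_part]) only sees the triples with p_k = p_i + p_j, each with the
    square of a structure constant of the frame. [resonance_combination] reassembles these scalar
    equations into the vector identity.

    The rest is linear algebra. Dividing by s > 0 exhibits 1_n - (T / s) p, the projection of 1_n to
    the hyperplane orthogonal to p, as an element of the cone. If T is nonzero, the identity puts s
    1_n - T p in the column span of V; since V^T p = 0 and V^T 1_n = 1_m, the normal equations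
    determine p ([spectral_normal_form]). Clearing denominators by det(V^T V) gives integers
    ([normal_form_int]). Finally p is determined up to scaling by its set of resonant triples, and
    there are finitely many such sets ([resonance_basis]). *)

Section Calculus.
Context {R : realType} {V : normedModType R}.
Implicit Types (f g : V -> R) (x v : V).

Lemma derivable_mulf f g x v : derivable f x v -> derivable g x v ->
  derivable (fun y => f y * g y) x v.
Proof. exact: derivableM. Qed.

Lemma derive_mulf f g x v : derivable f x v -> derivable g x v ->
  'D_v (fun y => f y * g y) x = ('D_v f x : R) * g x + f x * 'D_v g x.
Proof.
by move=> df dg; rewrite (deriveM df dg) addrC [X in X + _]mulrC.
Qed.

Lemma derivable_bigsum (I : Type) (r : seq I) (P : pred I) (F : I -> V -> R) x v :
  (forall i, derivable (F i) x v) ->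
  derivable (fun y => \sum_(i <- r | P i) F i y) x v.
Proof.
move=> dF; rewrite (_ : (fun _ => _) = \sum_(i <- r | P i) F i); last first.
  by apply/funext => y; rewrite fct_sumE.
elim/big_ind : _ => [|f g|i _]; [exact: derivable_cst|exact: derivableD|exact: dF].
Qed.

Lemma derive_bigsum (I : Type) (r : seq I) (P : pred I) (F : I -> V -> R) x v :
  (forall i, derivable (F i) x v) ->
  'D_v (fun y => \sum_(i <- r | P i) F i y) x = \sum_(i <- r | P i) 'D_v (F i) x.
Proof.
move=> dF; rewrite (_ : (fun _ => _) = \sum_(i <- r | P i) F i); last first.
  by apply/funext => y; rewrite fct_sumE.
suff : is_derive x v (\sum_(i <- r | P i) F i) (\sum_(i <- r | P i) 'D_v (F i) x).
  by move=> h; rewrite derive_val.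
elim/big_ind2 : _ => [|f f' g g' df dg|i _].
- exact: is_derive_cst.
- exact: is_deriveD.
- exact/derivableP/dF.
Qed.

Lemma derivable_mulmx m n p (M : V -> 'M[R]_(m, n)) (N : V -> 'M[R]_(n, p)) x v :
  derivable M x v -> derivable N x v -> derivable (fun y => M y *m N y) x v.
Proof.
move=> /derivable_mxP dM /derivable_mxP dN; apply/derivable_mxP => i j.
under eq_fun do rewrite mxE.
by apply: derivable_bigsum => k; exact: derivable_mulf.
Qed.

Lemma derive_mulmx m n p (M : V -> 'M[R]_(m, n)) (N : V -> 'M[R]_(n, p)) x v :
  derivable M x v -> derivable N x v ->
  'D_v (fun y => M y *m N y) x = 'D_v M x *m N x + M x *m 'D_v N x.
Proof.
move=> dM dN; rewrite (derive_mx (derivable_mulmx dM dN)) (derive_mx dM) (derive_mx dN).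
move: dM dN => /derivable_mxP dM /derivable_mxP dN.
apply/matrixP => i j; rewrite !mxE.
under eq_fun do rewrite mxE.
rewrite derive_bigsum; last by move=> k; exact: derivable_mulf.
by rewrite -big_split; apply: eq_bigr => k _; rewrite derive_mulf// !mxE.
Qed.

Lemma derivable_trmx m n (M : V -> 'M[R]_(m, n)) x v :
  derivable M x v -> derivable (fun y => (M y)^T) x v.
Proof.
move=> /derivable_mxP dM; apply/derivable_mxP => i j.
by under eq_fun do rewrite mxE; exact: dM.
Qed.

Lemma derive_trmx m n (M : V -> 'M[R]_(m, n)) x v :
  derivable M x v -> 'D_v (fun y => (M y)^T) x = ('D_v M x)^T.
Proof.
move=> dM; rewrite (derive_mx (derivable_trmx dM)) (derive_mx dM).
by apply/matrixP => i j; rewrite !mxE; under eq_fun do rewrite mxE.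
Qed.

Lemma derivable_addmx m n (M N : V -> 'M[R]_(m, n)) x v :
  derivable M x v -> derivable N x v -> derivable (fun y => M y + N y) x v.
Proof. exact: derivableD. Qed.

Lemma derive_addmx m n (M N : V -> 'M[R]_(m, n)) x v :
  derivable M x v -> derivable N x v ->
  'D_v (fun y => M y + N y) x = 'D_v M x + 'D_v N x.
Proof. exact: deriveD. Qed.

Let scalemxE m n f (M : V -> 'M[R]_(m, n)) i j :
  (fun y => (f y *: M y) i j) = (fun y => f y * M y i j).
Proof. by apply/funext => y; rewrite mxE. Qed.

Lemma derivable_scalemx m n f (M : V -> 'M[R]_(m, n)) x v :
  derivable f x v -> derivable M x v -> derivable (fun y => f y *: M y) x v.
Proof.
move=> df /derivable_mxP dM; apply/derivable_mxP => i j.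
rewrite (scalemxE f M i j); exact (derivable_mulf df (dM i j)).
Qed.

Lemma derive_scalemx m n f (M : V -> 'M[R]_(m, n)) x v :
  derivable f x v -> derivable M x v ->
  'D_v (fun y => f y *: M y) x = 'D_v f x *: M x + f x *: 'D_v M x.
Proof.
move=> df dM; rewrite (derive_mx (derivable_scalemx df dM)) (derive_mx dM).
move: dM => /derivable_mxP dM.
apply/matrixP => i j.
rewrite mxE.
rewrite (scalemxE f M i j).
rewrite (derive_mulf df (dM i j)).
by rewrite !mxE.
Qed.

Lemma derivable_summx m n (I : finType) (M : I -> V -> 'M[R]_(m, n)) x v :
  (forall k, derivable (M k) x v) -> derivable (fun y => \sum_k M k y) x v.
Proof.
move=> dM; apply/derivable_mxP => i j.
under eq_fun do rewrite summxE.
by apply: derivable_bigsum => k; exact: (derivable_mxP _ _ _).1.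
Qed.

Lemma derive_summx m n (I : finType) (M : I -> V -> 'M[R]_(m, n)) x v :
  (forall k, derivable (M k) x v) ->
  'D_v (fun y => \sum_k M k y) x = \sum_k 'D_v (M k) x.
Proof.
move=> dM; rewrite (derive_mx (derivable_summx dM)).
apply/matrixP => i j; rewrite !mxE summxE.
under eq_fun do rewrite summxE.
rewrite derive_bigsum; last by move=> k; exact: (derivable_mxP _ _ _).1.
by apply: eq_bigr => k _; rewrite (derive_mx (dM k)) mxE.
Qed.

Lemma derive_mxE m n (M : V -> 'M[R]_(m, n)) x v i j :
  derivable M x v -> ('D_v M x) i j = 'D_v (fun y => M y i j) x.
Proof. by move=> dM; rewrite (derive_mx dM) mxE. Qed.

Lemma derivable_entry m n (M : V -> 'M[R]_(m, n)) x v i j :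
  derivable M x v -> derivable (fun y => M y i j) x v.
Proof. by move=> /derivable_mxP. Qed.

Lemma open_near (U : set V) (x : V) (P : V -> Prop) :
  open U -> U x -> (forall y, U y -> P y) -> \forall y \near x, P y.
Proof. by move=> oU Ux UP; apply: filterS (open_nbhs_nbhs (conj oU Ux)). Qed.

Lemma eq_open_derive (W : normedModType R) (U : set V) (f g : V -> W) x v :
  open U -> U x -> (forall y, U y -> f y = g y) -> 'D_v f x = 'D_v g x.
Proof. by move=> oU Ux fg; apply: near_eq_derive; exact: open_near fg. Qed.

Lemma eq_open_derivable (W : normedModType R) (U : set V) (f g : V -> W) x v :
  open U -> U x -> (forall y, U y -> f y = g y) -> derivable f x v -> derivable g x v.
Proof. by move=> oU Ux fg; apply: near_eq_derivable; exact: open_near fg. Qed.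

End Calculus.

(** * Curvature of a connection and change of frame *)

Section MovingFrame.
Context {R : realType} {n : nat}.
Implicit Types (W H G : 'I_n -> 'rV[R]_n -> 'M[R]_n) (g E th : 'rV[R]_n -> 'M[R]_n).

(* For a connection given by nabla_j X = 'D_j X + X *m G j, the endomorphism
   X |-> X *m curvature G k j is R(d_k, d_j). *)
Definition curvature G (k j : 'I_n) x : 'M[R]_n :=
  'D_('e_k) (G j) x - 'D_('e_j) (G k) x + G j x *m G k x - G k x *m G j x.

Lemma christoffel_unique g (G : 'I_n -> 'M[R]_n) y :
  (g y)^T = g y -> g y \in unitmx ->
  (forall i j k, G i j k = G j i k) ->
  (forall i j l, pderive i (fun z => g z j l) y = (G i *m g y) j l + (G i *m g y) l j) ->
  forall i j k, christoffel g k i j y = G i j k.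
Proof.
move=> gsym gu Gsym dg i j k.
have ginv : (invmx (g y))^T = invmx (g y) by rewrite trmx_inv gsym.
have gE a b : g y a b = g y b a by rewrite -[in RHS]gsym mxE.
have gG a b l : (G a *m g y) b l = (G b *m g y) a l.
  by rewrite !mxE; apply: eq_bigr => m _; rewrite Gsym.
rewrite /christoffel.
transitivity (\sum_l (G i *m g y) j l * invmx (g y) l k).
  rewrite mulr_sumr; apply: eq_bigr => l _.
  rewrite !dg (gG j i) (gG j l) (gG i l) (_ : invmx (g y) k l = invmx (g y) l k).
    by field.
  by rewrite -[in LHS]ginv mxE.
transitivity ((G i *m g y *m invmx (g y)) j k); first by rewrite [RHS]mxE.
by rewrite mulmxK.
Qed.

Lemma ricci_curvature (U : set 'rV[R]_n) g G x : open U -> U x ->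
  (forall y, U y -> forall i j k, christoffel g k i j y = G i y j k) ->
  (forall y, U y -> forall i j k, G i y j k = G j y i k) ->
  (forall i k, derivable (G i) x 'e_k) ->
  forall i j, ricci g x i j = \sum_k curvature G k j x i k.
Proof.
move=> oU Ux chG Gsym dG i j; rewrite mxE; apply: eq_bigr => k _.
rewrite /curvature !mxE (derive_mxE _ _ (dG _ _)) (derive_mxE _ _ (dG _ _)) -addrA /pderive; congr (_ - _ + _).
- by refine (eq_open_derive _ oU Ux _) => y Uy; rewrite chG// Gsym.
- by refine (eq_open_derive _ oU Ux _) => y Uy; rewrite chG// Gsym.
- rewrite -sumrB; apply: eq_bigr => l _.
  by rewrite !chG// mulrC [X in _ - X]mulrC (Gsym _ Ux i j) (Gsym _ Ux i k).
Qed.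

Section Gauge.
Variables (U : set 'rV[R]_n) (E th : 'rV[R]_n -> 'M[R]_n).
Hypotheses (oU : open U).
Hypothesis Eth : forall y, U y -> E y *m th y = 1%:M.
Hypothesis dE : forall y, U y -> forall i, derivable E y 'e_i.
Hypothesis dth : forall y, U y -> forall i, derivable th y 'e_i.
Hypothesis ddth : forall y, U y -> forall i j, derivable ('D_('e_i) th) y 'e_j.

(* The connection for which the rows of [E] are parallel. *)
Definition flat_connection (j : 'I_n) y : 'M[R]_n := 'D_('e_j) th y *m E y.

Lemma derive_frame y i : U y -> 'D_('e_i) E y = - (E y *m flat_connection i y).
Proof.
move=> Uy.
have h : 'D_('e_i) (fun z => E z *m th z) y = 0.
  rewrite (@eq_open_derive _ _ _ U _ (cst 1%:M))//.
  exact: derive_cst.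
move: h; rewrite derive_mulmx//; [|exact: dE|exact: dth].
move=> /(congr1 (fun M => M *m E y)).
rewrite mul0mx mulmxDl -(mulmxA _ (th y)) (mulmx1C (Eth Uy)).
by rewrite mulmx1 -mulmxA => /eqP; rewrite addr_eq0 => /eqP.
Qed.

Lemma derivable_flat_connection x k j : U x -> derivable (flat_connection k) x 'e_j.
Proof. by move=> Ux; apply: derivable_mulmx; [exact: ddth|exact: dE]. Qed.

Variable om : 'I_n -> 'rV[R]_n -> 'M[R]_n.
Hypothesis dom : forall y, U y -> forall i j, derivable (om i) y 'e_j.

(** The connection with nabla_j E = om_j E, that is, with matrix [om j] in the frame [E], written in
    coordinates. *)
Definition gauged_connection (j : 'I_n) y : 'M[R]_n :=
  flat_connection j y + th y *m om j y *m E y.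

Lemma derivable_gauged_connection x k j : U x -> derivable (gauged_connection k) x 'e_j.
Proof.
move=> Ux; apply: derivable_addmx; first exact: derivable_flat_connection.
apply: derivable_mulmx; last exact: dE.
apply: derivable_mulmx; [exact: dth|exact: dom].
Qed.

Lemma derive_gauged_connection x k j : U x ->
  'D_('e_k) (gauged_connection j) x = 'D_('e_k) (flat_connection j) x
    + (flat_connection k x *m (th x *m om j x *m E x)
    + th x *m 'D_('e_k) (om j) x *m E x
    - (th x *m om j x *m E x) *m flat_connection k x).
Proof.
move=> Ux; have [[dEx dthx] domx] := (dE Ux, dth Ux, dom Ux).
have d1 : derivable (fun z => th z *m om j z) x 'e_k by exact: derivable_mulmx.
have d2 : derivable (flat_connection j) x 'e_k by exact: derivable_flat_connection.
rewrite /gauged_connection (derive_addmx d2 (derivable_mulmx d1 (dEx k))).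
rewrite (derive_mulmx d1 (dEx k)) (derive_mulmx (dthx k) (domx j k)) derive_frame//.
congr (_ + _).
rewrite mulmxDl; congr (_ + _ + _); last by rewrite mulmxN !mulmxA.
rewrite /flat_connection -!mulmxA; congr (_ *m _).
by rewrite mulmxA Eth// mul1mx.
Qed.

Let gauge_identity (t e a b a' b' wj wk oj ok : 'M[R]_n) : e *m t = 1%:M ->
  a + (wk *m (t *m oj *m e) + t *m a' *m e - (t *m oj *m e) *m wk)
  - (b + (wj *m (t *m ok *m e) + t *m b' *m e - (t *m ok *m e) *m wj))
  + (wj + t *m oj *m e) *m (wk + t *m ok *m e)
  - (wk + t *m ok *m e) *m (wj + t *m oj *m e) =
  a - b + wj *m wk - wk *m wj + t *m (a' - b' + oj *m ok - ok *m oj) *m e.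
Proof.
move=> et.
have tt c d : (t *m c *m e) *m (t *m d *m e) = t *m (c *m d) *m e.
  by rewrite !mulmxA -(mulmxA _ e t) et mulmx1.
rewrite !(mulmxDl wj) !(mulmxDl wk) !(mulmxDr wj) !(mulmxDr wk) !mulmxDr !tt.
rewrite ?mulmxDl ?mulmxN ?mulNmx.
(* Every matrix product becomes an opaque matrix; the remaining identity is additive and can be
   checked entry by entry. *)
repeat match goal with |- context [mulmx ?A ?B] => move: (mulmx A B) => ? end.
by apply/matrixP => i j; rewrite !mxE; ring.
Qed.

(** The derivatives of the frame contribute commutators of [om] with the flat connection, and these
    cancel against the cross terms of the quadratic part. What remains is the curvature of [om]
    conjugated by the frame, plus that of the flat connection. *)
Lemma curvature_gauge x k j : U x ->
  curvature gauged_connection k j x =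
  curvature flat_connection k j x + th x *m curvature om k j x *m E x.
Proof.
move=> Ux; rewrite /curvature.
rewrite (derive_gauged_connection k j Ux) (derive_gauged_connection j k Ux).
exact (gauge_identity _ _ _ _ _ _ _ _ (Eth Ux)).
Qed.

End Gauge.
End MovingFrame.

(** * Structure equations and Ricci curvature in an orthogonal moving frame *)

Section KoszulFrame.
Context {R : realType} {n : nat}.
Variables (U : set 'rV[R]_n) (E th : 'rV[R]_n -> 'M[R]_n).
Hypotheses (oU : open U).
Hypothesis Eth : forall y, U y -> E y *m th y = 1%:M.
Hypothesis dE : forall y, U y -> forall i, derivable E y 'e_i.
Hypothesis dth : forall y, U y -> forall i, derivable th y 'e_i.
Hypothesis ddth : forall y, U y -> forall i j, derivable ('D_('e_i) th) y 'e_j.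

Definition coframe_derivative (c : 'I_n) y : 'M[R]_n :=
  E y *m \sum_i E y c i *: 'D_('e_i) th y.

(* d(th_d)(E_c, E_a) = - th_d [E_c, E_a]. *)
Definition frame_torsion (c a d : 'I_n) y : R :=
  coframe_derivative c y a d - coframe_derivative a y c d.

Definition frame_derive (a : 'I_n) (h : 'rV[R]_n -> R) x : R :=
  \sum_k E x a k * 'D_('e_k) h x.

(* Row [d] of [A c y] holds the components in the frame [E] of nabla_(E_c) E_d. *)
Variable A : 'I_n -> 'rV[R]_n -> 'M[R]_n.
Hypothesis dA : forall y, U y -> forall c i, derivable (A c) y 'e_i.

Definition connection_form (j : 'I_n) y : 'M[R]_n := \sum_c th y j c *: A c y.

Let the y : U y -> th y *m E y = 1%:M. Proof. by move=> Uy; exact/mulmx1C/Eth. Qed.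

Lemma derivable_connection_form y i j : U y -> derivable (connection_form i) y 'e_j.
Proof.
move=> Uy; apply: derivable_summx => c; apply: derivable_scalemx; last exact: dA.
exact (derivable_entry (@dth y Uy j)).
Qed.

Lemma sum_frame_connection_form y q : U y ->
  \sum_j E y q j *: connection_form j y = A q y.
Proof.
move=> Uy; under eq_bigr do rewrite scaler_sumr.
rewrite exchange_big /= (bigD1 q)//= [X in _ + X]big1 ?addr0 => [|c cq].
- transitivity ((E y *m th y) q q *: A q y); last by rewrite Eth// mxE eqxx scale1r.
  by rewrite mxE scaler_suml; apply: eq_bigr => j _; rewrite scalerA.
- transitivity ((E y *m th y) q c *: A c y).
    by rewrite mxE scaler_suml; apply: eq_bigr => j _; rewrite scalerA.
  by rewrite Eth// mxE eq_sym (negbTE cq) scale0r.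
Qed.

Lemma sum_frame_derive_connection_form x q a : U x ->
  \sum_k \sum_j (E x a k * E x q j) *: 'D_('e_k) (connection_form j) x =
  \sum_k E x a k *: 'D_('e_k) (A q) x + \sum_c coframe_derivative a x q c *: A c x.
Proof.
move=> Ux.
have dthc i c k : derivable (fun y => th y i c) x 'e_k.
  exact (derivable_entry (@dth x Ux k)).
have step k : \sum_j E x q j *: 'D_('e_k) (connection_form j) x =
    'D_('e_k) (A q) x + \sum_c (E x *m 'D_('e_k) th x) q c *: A c x.
  transitivity (\sum_j \sum_c (E x q j *: (('D_('e_k) th x) j c *: A c x)
      + E x q j *: (th x j c *: 'D_('e_k) (A c) x))).
    apply: eq_bigr => j _; rewrite derive_summx; last first.
      by move=> c; apply: derivable_scalemx; [exact: dthc|exact: dA].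
    rewrite scaler_sumr; apply: eq_bigr => c _.
    rewrite derive_scalemx//; last exact: dA.
    by rewrite scalerDr derive_mxE//; exact: dth.
  rewrite exchange_big /=; under eq_bigr do rewrite big_split /=.
  rewrite big_split /= addrC; congr (_ + _).
    transitivity (\sum_c (E x *m th x) q c *: 'D_('e_k) (A c) x).
      apply: eq_bigr => c _; rewrite mxE scaler_suml.
      by apply: eq_bigr => j _; rewrite scalerA.
    rewrite Eth// (bigD1 q)//= big1 ?addr0 => [|c cq]; first by rewrite mxE eqxx scale1r.
    by rewrite mxE eq_sym (negbTE cq) scale0r.
  apply: eq_bigr => c _; rewrite mxE scaler_suml.
  by apply: eq_bigr => j _; rewrite scalerA.
transitivity (\sum_k E x a k *: \sum_j E x q j *: 'D_('e_k) (connection_form j) x).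
  by apply: eq_bigr => k _; rewrite scaler_sumr; apply: eq_bigr => j _; rewrite scalerA.
under eq_bigr do rewrite step scalerDr.
rewrite big_split /=; congr (_ + _).
under eq_bigr do rewrite scaler_sumr.
rewrite exchange_big /=; apply: eq_bigr => c _.
rewrite /coframe_derivative mulmx_sumr summxE scaler_suml; apply: eq_bigr => k _.
by rewrite -scalemxAr [in RHS]mxE scalerA.
Qed.

(** Cartan's structure equation evaluated on (E_a, E_q). The sum of [frame_torsion a q c] times
    [A c] is minus the connection along the bracket [E_a, E_q]; it arises from differentiating the
    coframe in [connection_form]. *)
Lemma sum_frame_curvature x q a : U x ->
  \sum_k \sum_j (E x a k * E x q j) *: curvature connection_form k j x =
  \sum_k E x a k *: 'D_('e_k) (A q) x - \sum_k E x q k *: 'D_('e_k) (A a) x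
  + \sum_c frame_torsion a q c x *: A c x
  + A q x *m A a x - A a x *m A q x.
Proof.
move=> Ux; rewrite /curvature.
have prod b d : \sum_k \sum_j (E x b k * E x d j) *:
    (connection_form j x *m connection_form k x) = A d x *m A b x.
  rewrite -(sum_frame_connection_form b Ux) -(sum_frame_connection_form d Ux).
  rewrite mulmx_sumr; apply: eq_bigr => k _.
  rewrite mulmx_suml; apply: eq_bigr => j _.
  by rewrite -scalemxAl -scalemxAr scalerA mulrC.
transitivity (\sum_k \sum_j (E x a k * E x q j) *: 'D_('e_k) (connection_form j) x
  - \sum_k \sum_j (E x q k * E x a j) *: 'D_('e_k) (connection_form j) x
  + \sum_k \sum_j (E x a k * E x q j) *: (connection_form j x *m connection_form k x)
  - \sum_k \sum_j (E x q k * E x a j) *: (connection_form j x *m connection_form k x)).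
  rewrite [in X in _ - X + _](exchange_big) [in X in _ + _ - X]exchange_big /=.
  rewrite -sumrB -big_split /= -sumrB; apply: eq_bigr => k _.
  rewrite -sumrB -big_split /= -sumrB; apply: eq_bigr => j _.
  by rewrite (mulrC (E x q j)) !scalerBr scalerDr scalerBr.
rewrite !prod !sum_frame_derive_connection_form//.
congr (_ + _ - _); rewrite opprD addrACA; congr (_ + _).
rewrite -sumrB; apply: eq_bigr => c _.
by rewrite -scalerBl.
Qed.

Lemma ricci_frame_gauge x q : U x ->
  \sum_j \sum_k E x q j *
    (E x *m curvature (gauged_connection E th connection_form) k j x) q k =
  \sum_j \sum_k E x q j * (E x *m curvature (flat_connection E th) k j x) q k
  + \sum_a (frame_derive a (fun y => A q y q a) x - frame_derive q (fun y => A a y q a) x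
     + \sum_c frame_torsion a q c x * A c x q a
     + \sum_d A q x q d * A a x d a - \sum_d A a x q d * A q x d a).
Proof.
move=> Ux.
have dom y : U y -> forall i j, derivable (connection_form i) y 'e_j.
  by move=> Uy i j; exact: derivable_connection_form.
transitivity (\sum_j \sum_k (E x q j * (E x *m curvature (flat_connection E th) k j x) q k
   + \sum_a E x q j * (curvature connection_form k j x q a * E x a k))).
  apply: eq_bigr => j _; apply: eq_bigr => k _.
  rewrite (curvature_gauge oU)// mulmxDr !mulmxA Eth// mul1mx.
  by rewrite mxE mulrDr [in X in _ + X]mxE mulr_sumr.
under eq_bigr do rewrite big_split /=.
rewrite big_split /=; congr (_ + _).
under eq_bigr do rewrite exchange_big /=.
rewrite exchange_big /=; apply: eq_bigr => a _.
have Aqa b c : frame_derive c (fun y => A b y q a) x =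
    (\sum_k E x c k *: 'D_('e_k) (A b) x) q a.
  by rewrite summxE; apply: eq_bigr => k _; rewrite mxE derive_mxE//; exact: dA.
transitivity ((\sum_k \sum_j (E x a k * E x q j) *: curvature connection_form k j x) q a).
  rewrite exchange_big /= summxE; apply: eq_bigr => k _.
  rewrite summxE; apply: eq_bigr => j _; rewrite [RHS]mxE; ring.
rewrite sum_frame_curvature// !Aqa.
rewrite !mxE; congr (_ + _ + _ - _).
by rewrite summxE; apply: eq_bigr => c _; rewrite mxE.
Qed.

Section Metric.
Variables (g : 'rV[R]_n -> 'M[R]_n) (f : 'rV[R]_n -> 'rV[R]_n).
Hypothesis df : forall y, U y -> forall i, derivable f y 'e_i.
Hypothesis f_neq0 : forall y, U y -> forall a, f y 0 a != 0.
Hypothesis gE : forall y, U y -> g y = th y *m diag_mx (f y) *m (th y)^T.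
Hypothesis A_metric : forall y, U y -> forall c d a,
  A c y d a * f y 0 a + A c y a d * f y 0 d =
  (d == a)%:R * frame_derive c (fun z => f z 0 a) y.
Hypothesis A_torsion : forall y, U y -> forall c d a,
  A c y d a - A d y c a = - frame_torsion c d a y.

Let G := gauged_connection E th connection_form.

Lemma sum_coframe_derivative y i : U y ->
  \sum_c th y i c *: coframe_derivative c y = E y *m 'D_('e_i) th y.
Proof.
move=> Uy; under eq_bigr do rewrite scalemxAr.
rewrite -mulmx_sumr; congr (_ *m _).
under eq_bigr do rewrite scaler_sumr.
rewrite exchange_big /=.
transitivity (\sum_k (th y *m E y) i k *: 'D_('e_k) th y).
  apply: eq_bigr => k _; rewrite mxE scaler_suml.
  by apply: eq_bigr => c _; rewrite scalerA.
rewrite the// (bigD1 i)//= big1 ?addr0 => [|c ci]; first by rewrite mxE eqxx scale1r.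
by rewrite mxE eq_sym (negbTE ci) scale0r.
Qed.

(** Multiplying by the coframe turns the connection into the derivative of [th] plus [th] times
    [connection_form]. In frame components the antisymmetric part is [frame_torsion] plus that of
    [A], and [A_torsion] says that these cancel. *)
Lemma gauged_connection_sym y i j k : U y -> G i y j k = G j y i k.
Proof.
move=> Uy.
have Gth l : G l y *m th y = 'D_('e_l) th y + th y *m connection_form l y.
  rewrite /G /gauged_connection /flat_connection mulmxDl -!mulmxA Eth//.
  by rewrite !mulmx1.
have GE l : G l y = (G l y *m th y) *m E y by rewrite -mulmxA the// mulmx1.
suff h a : (G i y *m th y) j a = (G j y *m th y) i a.
  by rewrite GE [in RHS]GE [LHS]mxE [RHS]mxE; apply: eq_bigr => a _; rewrite h.
rewrite !Gth.
have D l m : ('D_('e_l) th y) m a = \sum_c \sum_d th y l c * (th y m d * coframe_derivative c y d a).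
  transitivity ((th y *m \sum_c th y l c *: coframe_derivative c y) m a).
    by rewrite sum_coframe_derivative// mulmxA the// mul1mx.
  rewrite mulmx_sumr summxE; apply: eq_bigr => c _.
  by rewrite -scalemxAr mxE [in LHS]mxE mulr_sumr.
have O l m : (th y *m connection_form l y) m a = \sum_c \sum_d th y l c * (th y m d * A c y d a).
  rewrite mulmx_sumr summxE; apply: eq_bigr => c _.
  by rewrite -scalemxAr mxE [in LHS]mxE mulr_sumr.
have addE (M N : 'M[R]_n) b d : (M + N) b d = M b d + N b d by rewrite mxE.
rewrite !addE (D i j) (D j i) (O i j) (O j i) -!big_split /=.
under eq_bigr do rewrite -big_split /=.
under [RHS]eq_bigr do rewrite -big_split /=.
rewrite [RHS]exchange_big /=; apply: eq_bigr => c _; apply: eq_bigr => d _.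
have := A_torsion Uy c d a; rewrite /frame_torsion => h.
have -> : A c y d a = A d y c a - (coframe_derivative c y d a - coframe_derivative d y c a).
  by rewrite -h; ring.
by ring.
Qed.

Let metric_identity (d t o F : 'M[R]_n) : F^T = F ->
  (d *m F + t *m (o *m F + (o *m F)^T)) *m t^T + t *m F *m d^T =
  d *m F *m t^T + t *m (o *m F) *m t^T + (d *m F *m t^T + t *m (o *m F) *m t^T)^T.
Proof.
move=> Fsym; rewrite [in RHS](linearD (@trmx R n n)) /=.
rewrite (trmx_mul (d *m F)) (trmx_mul d) (trmx_mul (t *m _)) (trmx_mul t) !trmxK Fsym.
rewrite mulmxDr !mulmxDl !mulmxA.
move: (_ *m t^T) (_ *m t^T) (t *m F *m _) => a b c.
by rewrite -!addrA; congr (_ + (_ + _)); rewrite addrC.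
Qed.

(** Symmetry and metric compatibility, once transported from the frame to coordinates, leave
    [christoffel_unique] to conclude: the frame data [A] describe the Levi-Civita connection of
    [g]. *)
Lemma christoffel_frame y : U y -> forall i j k, christoffel g k i j y = G i y j k.
Proof.
move=> Uy; have ? := the Uy.
have gy := gE Uy.
have thu : th y \in unitmx by have [] := mulmx1_unit (Eth Uy).
apply: christoffel_unique.
- by rewrite gy !trmx_mul trmxK tr_diag_mx mulmxA.
- rewrite gy !unitmx_mul unitmx_tr thu andbT /=.
  rewrite unitmxE det_diag unitfE; apply/prodf_neq0 => a _; exact: f_neq0.
- by move=> i j k; exact: gauged_connection_sym.
move=> i j l.
have dF : derivable (fun z => diag_mx (f z)) y 'e_i.
  apply/derivable_mxP => a b; under eq_fun do rewrite mxE.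
  have [->|ab] := eqVneq a b; last by under eq_fun do rewrite mulr0n; exact: derivable_cst.
  under eq_fun do rewrite mulr1n; exact (derivable_entry (@df y Uy i)).
have dFE : 'D_('e_i) (fun z => diag_mx (f z)) y = diag_mx ('D_('e_i) f y).
  apply/matrixP => a b; rewrite derive_mxE// [RHS]mxE.
  under eq_fun do rewrite mxE.
  have [->|ab] := eqVneq a b; last by under eq_fun do rewrite mulr0n; rewrite derive_cst.
  by under eq_fun do rewrite mulr1n; rewrite derive_mxE//; exact: df.
have dthi : derivable th y 'e_i by exact: dth.
have dFi : diag_mx ('D_('e_i) f y) = connection_form i y *m diag_mx (f y)
    + (connection_form i y *m diag_mx (f y))^T.
  rewrite /connection_form mulmx_suml linear_sum -big_split /=.
  apply/matrixP => a b; rewrite summxE.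
  transitivity (\sum_c th y i c * ((a == b)%:R * frame_derive c (fun z => f z 0 b) y)); last first.
    apply: eq_bigr => c _; rewrite -(A_metric Uy) -scalemxAl mul_mx_diag !mxE; ring.
  rewrite [LHS]mxE.
  transitivity ((a == b)%:R * \sum_k (th y *m E y) i k * 'D_('e_k) (fun z => f z 0 b) y).
    rewrite the// (bigD1 i)//= big1 ?addr0 => [|c ci]; last first.
      by rewrite mxE eq_sym (negbTE ci) mul0r.
    rewrite mxE eqxx mul1r -derive_mxE; last exact: df.
    by case: eqP => [->|]; rewrite ?mulr1n ?mulr0n ?mul1r ?mul0r.
  rewrite mulr_sumr; under eq_bigr do rewrite mxE mulr_suml mulr_sumr.
  rewrite exchange_big /=; apply: eq_bigr => c _.
  rewrite /frame_derive !mulr_sumr; apply: eq_bigr => k _; ring.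
have Gg : G i y *m g y = 'D_('e_i) th y *m diag_mx (f y) *m (th y)^T
    + th y *m (connection_form i y *m diag_mx (f y)) *m (th y)^T.
  rewrite /G /gauged_connection /flat_connection mulmxDl gy !mulmxA.
  by rewrite -!(mulmxA _ (E y) (th y)) Eth// !mulmx1.
rewrite /pderive -derive_mxE; last first.
  refine (eq_open_derivable oU Uy _ _) => [z Uz|]; first by rewrite gE.
  apply: derivable_mulmx; last exact: derivable_trmx.
  exact: derivable_mulmx.
rewrite (_ : 'D_('e_i) g y = G i y *m g y + (G i y *m g y)^T); first by rewrite !mxE.
rewrite (eq_open_derive _ oU Uy gE).
rewrite (derive_mulmx (derivable_mulmx dthi dF) (derivable_trmx dthi)).
rewrite (derive_trmx dthi) (derive_mulmx dthi dF) dFE dFi Gg.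
exact/metric_identity/tr_diag_mx.
Qed.

(** Ric(E_q, E_q) as the trace of the structure equation. The first double sum is the contribution
    of the flat connection of the frame. *)
Lemma ricci_frame x q : U x ->
  (E x *m ricci g x *m (E x)^T) q q =
  \sum_j \sum_k E x q j * (E x *m curvature (flat_connection E th) k j x) q k
  + \sum_a (frame_derive a (fun y => A q y q a) x - frame_derive q (fun y => A a y q a) x
     + \sum_c frame_torsion a q c x * A c x q a
     + \sum_d A q x q d * A a x d a - \sum_d A a x q d * A q x d a).
Proof.
move=> Ux; rewrite -ricci_frame_gauge//.
have ric : forall i j, ricci g x i j = \sum_k curvature G k j x i k.
  apply: (ricci_curvature oU Ux christoffel_frame).
  - by move=> y Uy i j k; exact: gauged_connection_sym.
  - move=> i k.
    have dom y : U y -> forall a b, derivable (connection_form a) y 'e_b.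
      by move=> Uy a b; exact: derivable_connection_form.
    exact (derivable_gauged_connection dE dth ddth dom Ux).
rewrite mxE; apply: eq_bigr => j _; rewrite [X in _ * X]mxE mulrC -mulr_sumr.
congr (_ * _); rewrite mxE; under eq_bigr do rewrite ric mulr_sumr.
by rewrite exchange_big /=; apply: eq_bigr => k _; rewrite mxE.
Qed.

End Metric.
End KoszulFrame.

(** * Frames pulled back to the product of the real line with a chart *)

Lemma derivable_comp_linear (R : realType) (V V' W : normedModType R) (l : V -> V')
    (h : V' -> W) (v w : V) : (forall t x y, l (t *: x + y) = t *: l x + l y) ->
  derivable h (l v) (l w) -> derivable (fun x => h (l x)) v w.
Proof.
move=> ll; rewrite /derivable (_ : (fun _ => _) =
  fun t : R => t^-1 *: (((fun x => h (l x)) \o shift v) (t *: w) - h (l v)))//.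
by apply/funext => t /=; rewrite ll.
Qed.

Lemma derive_comp_linear (R : realType) (V V' W : normedModType R) (l : V -> V')
    (h : V' -> W) (v w : V) : (forall t x y, l (t *: x + y) = t *: l x + l y) ->
  'D_w (fun x => h (l x)) v = 'D_(l w) h (l v).
Proof.
move=> ll; rewrite /derive.
suff -> : (fun t : R => t^-1 *: (((fun x => h (l x)) \o shift v) (t *: w) - h (l v))) =
  (fun t : R => t^-1 *: ((h \o shift (l v)) (t *: l w) - h (l v))) by [].
by apply/funext => t /=; rewrite ll.
Qed.

Section ExtensionFrame.
Context {R : realType} {n : nat}.
Implicit Types (M : 'rV[R]_n -> 'M[R]_n) (v : 'rV[R]_(1 + n)).

Local Notation z := (lshift n (ord0 : 'I_1)).

(** With [c] = 1 this extends frames and coframes of N by d_u and du; with [c] = 0 it extends their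
    derivatives. *)
Definition extend_mx (c : R) M v : 'M[R]_(1 + n) := block_mx c%:M 0 0 (M (rsubmx v)).

Lemma rsubmx_delta_l : rsubmx ('e_z : 'rV[R]_(1 + n)) = 0.
Proof. by apply/rowP => j; rewrite !mxE eq_rlshift andbF. Qed.

Lemma rsubmx_delta_r (j : 'I_n) : rsubmx ('e_(rshift 1 j) : 'rV[R]_(1 + n)) = 'e_j.
Proof. by apply/rowP => k; rewrite !mxE eq_rshift. Qed.

Let rsub_lin (t : R) (x y : 'rV[R]_(1 + n)) : rsubmx (t *: x + y) = t *: rsubmx x + rsubmx y.
Proof. by rewrite linearP. Qed.

Let lsub_lin (t : R) (x y : 'rV[R]_(1 + n)) :
  lsubmx (t *: x + y) 0 0 = t *: lsubmx x 0 0 + lsubmx y 0 0.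
Proof. by rewrite !mxE. Qed.

Section RightFunctions.
Context {W : normedModType R}.
Variable h : 'rV[R]_n -> W.

Lemma derive_rsub_l v : 'D_('e_z) (fun x => h (rsubmx x)) v = 0.
Proof. by rewrite (@derive_comp_linear _ _ _ _ (@rsubmx _ _ _ _) h v _ rsub_lin) rsubmx_delta_l derive0. Qed.

Lemma derive_rsub_r v j : 'D_('e_(rshift 1 j)) (fun x => h (rsubmx x)) v =
  'D_('e_j) h (rsubmx v).
Proof. by rewrite (@derive_comp_linear _ _ _ _ (@rsubmx _ _ _ _) h v _ rsub_lin) rsubmx_delta_r. Qed.

Lemma derivable_rsub v : (forall j, derivable h (rsubmx v) 'e_j) ->
  forall i, derivable (fun x => h (rsubmx x)) v 'e_i.
Proof.
move=> dh i; apply: (@derivable_comp_linear _ _ _ _ (@rsubmx _ _ _ _)) => //.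
case: (split_ordP i) => [i0 -> |j ->]; last by rewrite rsubmx_delta_r.
by rewrite (ord1 i0) rsubmx_delta_l; exact: derivable0.
Qed.
End RightFunctions.

Lemma derive_extend_mx_l c M v : 'D_('e_z) (extend_mx c M) v = 0.
Proof. exact: (derive_rsub_l (fun y => block_mx c%:M 0 0 (M y))). Qed.

Let derivable_block c M y i : derivable M y 'e_i ->
  derivable (fun y => block_mx c%:M 0 0 (M y) : 'M[R]_(1 + n)) y 'e_i.
Proof.
move=> dM; apply/derivable_mxP => a b.
case: (split_ordP a) => [a0 ->|a' ->]; case: (split_ordP b) => [b0 ->|b' ->].
- by under eq_fun do rewrite block_mxEul; exact: derivable_cst.
- by under eq_fun do rewrite block_mxEur mxE; exact: derivable_cst.
- by under eq_fun do rewrite block_mxEdl mxE; exact: derivable_cst.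
- by under eq_fun do rewrite block_mxEdr; exact (derivable_entry dM).
Qed.

Lemma derivable_extend_mx c M v : (forall j, derivable M (rsubmx v) 'e_j) ->
  forall i, derivable (extend_mx c M) v 'e_i.
Proof.
move=> dM; apply: (derivable_rsub (h := fun y => block_mx c%:M 0 0 (M y))) => j.
exact: derivable_block.
Qed.

Lemma derive_extend_mx_r c M v j : derivable M (rsubmx v) 'e_j ->
  'D_('e_(rshift 1 j)) (extend_mx c M) v = extend_mx 0 ('D_('e_j) M) v.
Proof.
move=> dM; rewrite (derive_rsub_r (fun y => block_mx c%:M 0 0 (M y))).
have db := @derivable_block c _ _ _ dM.
apply/matrixP => a b; rewrite (derive_mxE a b db) /extend_mx.
case: (split_ordP a) => [a0 ->|a' ->]; case: (split_ordP b) => [b0 ->|b' ->].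
- under eq_fun do rewrite block_mxEul.
  by rewrite derive_cst block_mxEul !mxE mul0rn.
- under eq_fun do rewrite block_mxEur mxE.
  by rewrite derive_cst block_mxEur mxE.
- under eq_fun do rewrite block_mxEdl mxE.
  by rewrite derive_cst block_mxEdl mxE.
- under eq_fun do rewrite block_mxEdr.
  by rewrite block_mxEdr (derive_mxE _ _ dM).
Qed.

Lemma mul_extend_mx (c d : R) (A B : 'M[R]_n) :
  block_mx (c%:M : 'M[R]_1) 0 0 A *m block_mx d%:M 0 0 B = block_mx (c * d)%:M 0 0 (A *m B).
Proof.
by rewrite mulmx_block !(mulmx0, mul0mx, addr0, add0r) -scalar_mxM.
Qed.

Lemma open_rsubmx (U : set 'rV[R]_n) : open U -> open [set v : 'rV[R]_(1 + n) | U (rsubmx v)].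
Proof.
move=> oU; apply: (@open_comp _ _ (@rsubmx R 1 1 n) U) => // v _.
exact/differentiable_continuous/differentiable_rsubmx.
Qed.

End ExtensionFrame.

(** * The Ricci tensor of the extension *)

Section ExtensionRicci.
Context {R : realType} {n : nat}.
Variables (U : set 'rV[R]_n) (E th : 'rV[R]_n -> 'M[R]_n) (p : 'cV[R]_n).
Hypotheses (oU : open U).
Hypothesis Eth : forall y, U y -> E y *m th y = 1%:M.
Hypothesis dE : forall y, U y -> forall i, derivable E y 'e_i.
Hypothesis dth : forall y, U y -> forall i, derivable th y 'e_i.
Hypothesis ddth : forall y, U y -> forall i j, derivable ('D_('e_i) th) y 'e_j.
Implicit Types v : 'rV[R]_(1 + n).

Local Notation z := (lshift n (ord0 : 'I_1)).
Local Notation r := (rshift 1).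

Definition weight (a : 'I_n) v : R := expR (2 * lsubmx v 0 0 * p a 0).

Let EM := extend_mx 1 E.
Let tM := extend_mx 1 th.
Let UM := [set v : 'rV[R]_(1 + n) | U (rsubmx v)].
Let T (c a d : 'I_n) v := frame_torsion E th c a d (rsubmx v).

Lemma weight_gt0 a v : 0 < weight a v. Proof. exact: expR_gt0. Qed.

Let weight_neq0 a v : weight a v != 0. Proof. exact/lt0r_neq0/weight_gt0. Qed.

Let lsub_lin (t : R) (x y : 'rV[R]_(1 + n)) :
  lsubmx (t *: x + y) 0 0 = t *: lsubmx x 0 0 + lsubmx y 0 0.
Proof. by rewrite !mxE. Qed.

Let weight_is_derive a (t : R) :
  is_derive t 1 (fun t => expR (2 * t * p a 0)) (2 * p a 0 * expR (2 * t * p a 0)).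
Proof.
have h : is_derive t (1 : R) (fun t => 2 * t * p a 0) (2 * p a 0).
  rewrite (_ : (fun t => _) = (2 * p a 0) *: (id : R -> R)).
    by apply: is_derive_eq; rewrite [LHS]mulr1.
  by apply/funext => s /=; rewrite /GRing.scale /= mulrAC.
apply: is_derive_eq (is_derive1_comp (is_derive_expR _) h) _.
by rewrite mulrC.
Qed.

Let lsub_e_z : lsubmx ('e_z : 'rV[R]_(1 + n)) 0 0 = 1.
Proof. by rewrite !mxE !eqxx. Qed.

Let lsub_e_r j : lsubmx ('e_(r j) : 'rV[R]_(1 + n)) 0 0 = 0.
Proof. by rewrite !mxE eq_lrshift andbF. Qed.

Let weight_comp a w v : 'D_w (weight a) v =
  'D_(lsubmx w 0 0) (fun t : R => expR (2 * t * p a 0)) (lsubmx v 0 0).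
Proof. exact: (@derive_comp_linear _ _ _ _ (fun x => lsubmx x 0 0 : R) (fun t : R => expR (2 * t * p a 0)) v w lsub_lin). Qed.

Lemma derive_weight_l a v : 'D_('e_z) (weight a) v = 2 * p a 0 * weight a v.
Proof. by rewrite weight_comp lsub_e_z; exact: derive_val. Qed.

Lemma derive_weight_r a j v : 'D_('e_(r j)) (weight a) v = 0.
Proof. by rewrite weight_comp lsub_e_r derive0. Qed.

Lemma derivable_weight a v i : derivable (weight a) v 'e_i.
Proof.
apply: (@derivable_comp_linear _ _ _ _ (fun x => lsubmx x 0 0 : R) (fun t : R => expR (2 * t * p a 0)) v 'e_i lsub_lin).
case: (split_ordP i) => [i0 ->|j ->]; last by rewrite lsub_e_r; exact: derivable0.
by rewrite (ord1 i0) lsub_e_z; exact: ex_derive.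
Qed.

(** Entry (d, a) is the E_a-component of nabla_(E_c) E_d by the Koszul formula. The frame is
    orthogonal with squared lengths [weight], constant along N, so no derivative of the lengths
    enters. *)
Definition koszul (c : 'I_n) v : 'M[R]_n := \matrix_(d, a)
  (2^-1 * (T c a d v * (weight d v / weight a v) + T d a c v * (weight c v / weight a v)
           - T c d a v)).

(* In the frame (d_u, E_1, ..., E_n): the covariant derivative of E_a along d_u
   and that of d_u along E_a are both p_a E_a, and the d_u-component of
   nabla_(E_c) E_d is - p_c g^u(E_c, E_d). *)
Definition extension_connection (c : 'I_(1 + n)) v : 'M[R]_(1 + n) :=
  match fintype.split c with
  | inl _ => block_mx 0 0 0 (diag_mx p^T)
  | inr c => block_mx 0 (p c 0 *: delta_mx 0 c) (- (p c 0 * weight c v) *: delta_mx c 0)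
               (koszul c v)
  end.

Let A := extension_connection.

Let Az v : A z v = block_mx 0 0 0 (diag_mx p^T).
Proof. by rewrite /A /extension_connection (unsplitK (inl ord0)). Qed.

Let Ar c v : A (r c) v = block_mx 0 (p c 0 *: delta_mx 0 c)
  (- (p c 0 * weight c v) *: delta_mx c 0) (koszul c v).
Proof. by rewrite /A /extension_connection (unsplitK (inr c)). Qed.

Let Azzz v : A z v z z = 0. Proof. by rewrite Az block_mxEul mxE. Qed.
Let Azzr v a : A z v z (r a) = 0. Proof. by rewrite Az block_mxEur mxE. Qed.
Let Azrz v d : A z v (r d) z = 0. Proof. by rewrite Az block_mxEdl mxE. Qed.
Let Azrr v d a : A z v (r d) (r a) = p a 0 *+ (d == a).
Proof. by rewrite Az block_mxEdr !mxE; case: eqP => [->|]. Qed.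
Let Arzz v c : A (r c) v z z = 0. Proof. by rewrite Ar block_mxEul mxE. Qed.
Let Arzr v c a : A (r c) v z (r a) = p c 0 * (a == c)%:R.
Proof. by rewrite Ar block_mxEur !mxE. Qed.
Let Arrz v c d : A (r c) v (r d) z = - (p c 0 * weight c v) * (d == c)%:R.
Proof. by rewrite Ar block_mxEdl !mxE eqxx andbT. Qed.
Let Arrr v c d a : A (r c) v (r d) (r a) = 2^-1 * (T c a d v * (weight d v / weight a v)
  + T d a c v * (weight c v / weight a v) - T c d a v).
Proof. by rewrite Ar block_mxEdr !mxE. Qed.

Definition frame_weights v : 'rV[R]_(1 + n) := row_mx (const_mx 1) (\row_a weight a v).

Let fz v : frame_weights v 0 z = 1. Proof. by rewrite row_mxEl mxE. Qed.
Let fr v a : frame_weights v 0 (r a) = weight a v. Proof. by rewrite row_mxEr mxE. Qed.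

Let oUM : open UM. Proof. exact: open_rsubmx. Qed.

Let EthM v : UM v -> EM v *m tM v = 1%:M.
Proof.
by move=> Uv; rewrite /EM /tM /extend_mx mul_extend_mx Eth// mulr1 scalar_mx_block.
Qed.

Let dEM v : UM v -> forall i, derivable EM v 'e_i.
Proof. by move=> Uv; apply: derivable_extend_mx => j; exact: dE. Qed.

Let dtM v : UM v -> forall i, derivable tM v 'e_i.
Proof. by move=> Uv; apply: derivable_extend_mx => j; exact: dth. Qed.

Let DtMz v : 'D_('e_z) tM v = 0.
Proof. exact: derive_extend_mx_l. Qed.

Let DtMr v j : UM v -> 'D_('e_(r j)) tM v = extend_mx 0 ('D_('e_j) th) v.
Proof. by move=> Uv; apply: derive_extend_mx_r; exact: dth. Qed.

Let ddtM v : UM v -> forall i j, derivable ('D_('e_i) tM) v 'e_j.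
Proof.
move=> Uv i j; case: (split_ordP i) => [i0 ->|k ->].
  rewrite (ord1 i0) (_ : 'D_('e_z) tM = cst 0); first exact: derivable_cst.
  by apply/funext => x; exact: DtMz.
apply: (eq_open_derivable (f := extend_mx 0 ('D_('e_k) th)) oUM Uv) => [y Uy|].
  by rewrite DtMr.
by apply: derivable_extend_mx => l; exact: ddth.
Qed.

Let EMz v k : EM v z (r k) = 0. Proof. by rewrite /EM /extend_mx block_mxEur mxE. Qed.
Let EMzz v : EM v z z = 1. Proof. by rewrite /EM /extend_mx block_mxEul mxE eqxx. Qed.
Let EMrz v c : EM v (r c) z = 0. Proof. by rewrite /EM /extend_mx block_mxEdl mxE. Qed.
Let EMrr v c k : EM v (r c) (r k) = E (rsubmx v) c k.
Proof. by rewrite /EM /extend_mx block_mxEdr. Qed.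

Let coz v : UM v -> coframe_derivative EM tM z v = 0.
Proof.
move=> Uv; rewrite /coframe_derivative big_split_ord big_ord1 /= DtMz scaler0 add0r.
by rewrite big1 ?mulmx0// => k _; rewrite EMz scale0r.
Qed.

Let cor c v : UM v -> coframe_derivative EM tM (r c) v =
  block_mx 0 0 0 (coframe_derivative E th c (rsubmx v)).
Proof.
move=> Uv; rewrite /coframe_derivative big_split_ord big_ord1 /= DtMz scaler0 add0r.
have -> : \sum_(i < n) EM v (r c) (r i) *: 'D_('e_(r i)) tM v =
    block_mx (0%:M : 'M[R]_1) 0 0 (\sum_i E (rsubmx v) c i *: 'D_('e_i) th (rsubmx v)).
  under eq_bigr => i _ do rewrite EMrr DtMr// /extend_mx.
  apply/matrixP => a b; rewrite summxE.
  case: (split_ordP a) => [a0 ->|a' ->]; case: (split_ordP b) => [b0 ->|b' ->].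
  - rewrite block_mxEul big1 => [|i _]; first by rewrite mxE mul0rn.
    by rewrite mxE block_mxEul mxE mul0rn mulr0.
  - rewrite block_mxEur big1 => [|i _]; first by rewrite mxE.
    by rewrite mxE block_mxEur mxE mulr0.
  - rewrite block_mxEdl big1 => [|i _]; first by rewrite mxE.
    by rewrite mxE block_mxEdl mxE mulr0.
  - by rewrite block_mxEdr summxE; apply: eq_bigr => i _; rewrite mxE block_mxEdr [RHS]mxE.
rewrite /EM /extend_mx mul_extend_mx mulr0.
by rewrite (_ : 0%:M = 0 :> 'M[R]_1)//; apply/matrixP => a b; rewrite !mxE mul0rn.
Qed.

Let tor_rrr v c a d : UM v -> frame_torsion EM tM (r c) (r a) (r d) v = T c a d v.
Proof. by move=> Uv; rewrite /frame_torsion !cor// !block_mxEdr. Qed.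
Let tor_zr v a d : UM v -> frame_torsion EM tM z (r a) d v = 0.
Proof.
move=> Uv; rewrite /frame_torsion coz// cor// mxE.
by case: (split_ordP d) => [d0 ->|d' ->]; rewrite ?block_mxEul ?block_mxEur mxE subrr.
Qed.
Let tor_rz v a d : UM v -> frame_torsion EM tM (r a) z d v = 0.
Proof. by move=> Uv; rewrite -[LHS]opprK -[X in - X]/(- (_ - _)) opprB -/(frame_torsion _ _ _ _ _ _) tor_zr ?oppr0. Qed.
Let tor_zz v d : frame_torsion EM tM z z d v = 0.
Proof. by rewrite /frame_torsion subrr. Qed.
Let tor_rrz v c a : UM v -> frame_torsion EM tM (r c) (r a) z v = 0.
Proof. by move=> Uv; rewrite /frame_torsion !cor// !block_mxEdl !mxE subrr. Qed.

Let Tanti c a d v : T c a d v = - T a c d v.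
Proof. by rewrite /T /frame_torsion opprB. Qed.

Let Tdiag c d v : T c c d v = 0.
Proof. by rewrite /T /frame_torsion subrr. Qed.

Lemma derivable_frame_torsion y c a d i : U y -> derivable (frame_torsion E th c a d) y 'e_i.
Proof.
move=> Uy.
have h (b e f : 'I_n) : derivable (fun x => coframe_derivative E th b x e f) y 'e_i.
  have dEy : derivable E y 'e_i by exact: dE.
  have dDy k : derivable ('D_('e_k) th) y 'e_i by exact: ddth.
  exact (derivable_entry (derivable_mulmx dEy
    (derivable_summx (fun k => derivable_scalemx (derivable_entry dEy) (dDy k))))).
exact (derivableB (h c a d) (h a c d)).
Qed.

Let dT c a d v i : UM v -> derivable (T c a d) v 'e_i.
Proof.
move=> Uv; apply: (derivable_rsub (h := frame_torsion E th c a d)) => j.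
exact: derivable_frame_torsion.
Qed.

Let dquot a b v i : derivable (fun v => weight a v / weight b v) v 'e_i.
Proof.
exact (derivable_mulf (@derivable_weight a v i) (derivableV (weight_neq0 b v) (@derivable_weight b v i))).
Qed.

Let dA v : UM v -> forall c i, derivable (A c) v 'e_i.
Proof.
move=> Uv c i; case: (split_ordP c) => [c0 ->|c' ->].
  rewrite (ord1 c0) (_ : A z = cst (block_mx 0 0 0 (diag_mx p^T))); first exact: derivable_cst.
  by apply/funext => x; rewrite Az.
apply/derivable_mxP => a b.
case: (split_ordP a) => [a0 ->|a' ->]; case: (split_ordP b) => [b0 ->|b' ->].
- by rewrite (ord1 a0) (ord1 b0); under eq_fun do rewrite Arzz; exact: derivable_cst.
- by rewrite (ord1 a0); under eq_fun do rewrite Arzr; exact: derivable_cst.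
- rewrite (ord1 b0); under eq_fun do rewrite Arrz.
  apply: (derivable_mulf _ (derivable_cst _ _ _)).
  apply: derivableN; apply: (derivable_mulf (derivable_cst _ _ _)).
  exact: derivable_weight.
- under eq_fun do rewrite Arrr.
  exact (derivable_mulf (derivable_cst _ _ _) (derivableB (derivableD
    (derivable_mulf (@dT c' b' a' v i Uv) (@dquot a' b' v i))
    (derivable_mulf (@dT a' b' c' v i Uv) (@dquot c' b' v i))) (@dT c' a' b' v i Uv))).
Qed.

Let fdz h v : frame_derive EM z h v = 'D_('e_z) h v.
Proof.
rewrite /frame_derive big_split_ord big_ord1 /= EMzz mul1r big1 ?addr0// => k _.
by rewrite EMz mul0r.
Qed.

Let fdr c h v : frame_derive EM (r c) h v =
  \sum_j E (rsubmx v) c j * 'D_('e_(r j)) h v.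
Proof.
rewrite /frame_derive big_split_ord big_ord1 /= EMrz mul0r add0r.
by apply: eq_bigr => j _; rewrite EMrr.
Qed.

Let frame_weights_neq0 v : UM v -> forall a, frame_weights v 0 a != 0.
Proof.
move=> _ a; case: (split_ordP a) => [a0 ->|a' ->]; last by rewrite fr.
by rewrite (ord1 a0) fz oner_neq0.
Qed.

Let derivable_frame_weights v : UM v -> forall i, derivable frame_weights v 'e_i.
Proof.
move=> _ i; apply/derivable_mxP => a b; rewrite (ord1 a).
case: (split_ordP b) => [b0 ->|b' ->].
  by rewrite (ord1 b0); under eq_fun do rewrite fz; exact: derivable_cst.
by under eq_fun do rewrite fr; exact: derivable_weight.
Qed.

Let fdz_z v c : frame_derive EM c (fun x => frame_weights x 0 z) v = 0.
Proof.
under eq_fun do rewrite fz.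
by rewrite /frame_derive big1// => k _; rewrite derive_cst mulr0.
Qed.

Let fdz_r v a : frame_derive EM z (fun x => frame_weights x 0 (r a)) v = 2 * p a 0 * weight a v.
Proof. by under eq_fun do rewrite fr; rewrite fdz derive_weight_l. Qed.

Let fdr_r v c a : frame_derive EM (r c) (fun x => frame_weights x 0 (r a)) v = 0.
Proof.
under eq_fun do rewrite fr.
by rewrite fdr big1// => j _; rewrite derive_weight_r mulr0.
Qed.

(** Together with [A_torsion], this identifies [extension_connection] as the Levi-Civita connection
    of du^2 + g^u. The only nonzero derivative of a squared length is along d_u, where it is 2 p_a
    times the weight; this accounts for the entries involving p. *)
Let A_metric v : UM v -> forall c d a,
  A c v d a * frame_weights v 0 a + A c v a d * frame_weights v 0 d =
  (d == a)%:R * frame_derive EM c (fun x => frame_weights x 0 a) v.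
Proof.
move=> Uv c d a.
case: (split_ordP c) => [c0 ->|c' ->]; rewrite ?(ord1 c0);
case: (split_ordP d) => [d0 ->|d' ->]; rewrite ?(ord1 d0);
case: (split_ordP a) => [a0 ->|a' ->]; rewrite ?(ord1 a0) ?fz ?fr ?fdz_z ?fdz_r ?fdr_r.
- by rewrite Azzz !mul0r addr0 mulr0.
- by rewrite Azzr Azrz eq_lrshift !mul0r addr0.
- by rewrite Azzr Azrz eq_rlshift; ring.
- rewrite !Azrr eq_rshift (eq_sym a' d').
  by case: eqP => [->|_]; rewrite ?mulr1n ?mulr0n; ring.
- by rewrite Arzz; ring.
- by rewrite Arzr Arrz; case: eqP => [->|_] /=; rewrite ?mulr1n ?mulr0n; ring.
- by rewrite Arzr Arrz; case: eqP => [->|_] /=; rewrite ?mulr1n ?mulr0n; ring.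
- rewrite !Arrr (Tanti d' a').
  by field; rewrite !weight_neq0.
Qed.

Let A_torsion v : UM v -> forall c d a,
  A c v d a - A d v c a = - frame_torsion EM tM c d a v.
Proof.
move=> Uv c d a.
case: (split_ordP c) => [c0 ->|c' ->]; rewrite ?(ord1 c0);
case: (split_ordP d) => [d0 ->|d' ->]; rewrite ?(ord1 d0).
- by rewrite tor_zz subrr oppr0.
- rewrite tor_zr// oppr0; case: (split_ordP a) => [a0 ->|a' ->]; rewrite ?(ord1 a0).
    by rewrite Azrz Arzz subrr.
  by rewrite Azrr Arzr eq_sym; case: eqP => [->|_] /=; rewrite ?mulr1n ?mulr0n; ring.
- rewrite tor_rz// oppr0; case: (split_ordP a) => [a0 ->|a' ->]; rewrite ?(ord1 a0).
    by rewrite Azrz Arzz subrr.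
  by rewrite Azrr Arzr eq_sym; case: eqP => [->|_] /=; rewrite ?mulr1n ?mulr0n; ring.
- case: (split_ordP a) => [a0 ->|a' ->]; rewrite ?(ord1 a0).
    rewrite tor_rrz// !Arrz (eq_sym c' d').
    by case: eqP => [->|_] /=; rewrite ?mulr1n ?mulr0n; ring.
  rewrite tor_rrr// !Arrr (Tanti d' c').
  by field; rewrite !weight_neq0.
Qed.

Let flat_z : flat_connection EM tM z = cst 0.
Proof. by apply/funext => v; rewrite /flat_connection DtMz mul0mx. Qed.

Let flat_r j v : UM v -> flat_connection EM tM (r j) v = extend_mx 0 (flat_connection E th j) v.
Proof.
move=> Uv; rewrite /flat_connection DtMr// /EM /extend_mx.
by rewrite mul_extend_mx mul0r.
Qed.

Let Dflat_r j v k : UM v -> 'D_('e_k) (flat_connection EM tM (r j)) v =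
  'D_('e_k) (extend_mx 0 (flat_connection E th j)) v.
Proof. by move=> Uv; apply: (eq_open_derive _ oUM Uv); exact: flat_r. Qed.

Let curv_z v j : UM v -> curvature (flat_connection EM tM) z j v = 0.
Proof.
move=> Uv; rewrite /curvature flat_z derive_cst mulmx0 mul0mx !subr0.
case: (split_ordP j) => [j0 ->|j' ->]; first by rewrite (ord1 j0) flat_z derive_cst addr0.
by rewrite (@Dflat_r j' v z Uv) derive_extend_mx_l addr0.
Qed.

Let curv_rz v k : UM v -> curvature (flat_connection EM tM) (r k) z v = 0.
Proof.
move=> Uv; rewrite /curvature flat_z derive_cst mulmx0 mul0mx !subr0.
by rewrite (@Dflat_r k v z Uv) derive_extend_mx_l subr0 addr0.
Qed.

Let curvature_eq m (W : 'I_m -> 'rV[R]_m -> 'M[R]_m) k j x a b c d :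
  'D_('e_k) (W j) x = a -> 'D_('e_j) (W k) x = b -> W j x = c -> W k x = d ->
  curvature W k j x = a - b + c *m d - d *m c.
Proof. by move=> <- <- <- <-. Qed.

Let curvature_block (a b c d : 'M[R]_n) :
  let B M := block_mx (0%:M : 'M[R]_1) 0 0 M in
  B a - B b + B c *m B d - B d *m B c = B (a - b + c *m d - d *m c).
Proof.
move=> B; rewrite /B !mul_extend_mx mul0r !opp_block_mx !add_block_mx.
by rewrite (_ : 0%:M = 0) ?(oppr0, addr0)//; apply/matrixP => i k; rewrite !mxE mul0rn.
Qed.

Let curv_rr v k j : UM v -> curvature (flat_connection EM tM) (r k) (r j) v =
  block_mx (0%:M : 'M[R]_1) 0 0 (curvature (flat_connection E th) k j (rsubmx v)).
Proof.
move=> Uv.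
have dflat a b : derivable (flat_connection E th a) (rsubmx v) 'e_b.
  exact (derivable_flat_connection dE ddth Uv).
have D a b : 'D_('e_(r b)) (flat_connection EM tM (r a)) v =
    extend_mx 0 ('D_('e_b) (flat_connection E th a)) v.
  by rewrite (@Dflat_r a v (r b) Uv) (derive_extend_mx_r _ (@dflat a b)).
rewrite (curvature_eq (D j k) (D k j) (@flat_r j v Uv) (@flat_r k v Uv)).
exact: curvature_block.
Qed.

(** This would vanish by the equality of mixed second partial derivatives of the coframe. It
    suffices that it is independent of u: after division by the weight of E_q it carries the nonzero
    frequency - 2 p_q. *)
Definition flat_ricci (q : 'I_n) y : R :=
  \sum_j \sum_k E y q j * (E y *m curvature (flat_connection E th) k j y) q k.

Let flat_ricci_z v : UM v -> \sum_j \sum_k EM v z j *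
  (EM v *m curvature (flat_connection EM tM) k j v) z k = 0.
Proof.
move=> Uv; rewrite big1// => j _; rewrite big1// => k _.
case: (split_ordP j) => [j0 ->|j' ->]; last by rewrite EMz mul0r.
rewrite (ord1 j0); case: (split_ordP k) => [k0 ->|k' ->].
  by rewrite (ord1 k0) curv_z// mulmx0 [X in _ * X]mxE mulr0.
by rewrite curv_rz// mulmx0 [X in _ * X]mxE mulr0.
Qed.

Let flat_ricci_r v q : UM v -> \sum_j \sum_k EM v (r q) j *
  (EM v *m curvature (flat_connection EM tM) k j v) (r q) k = flat_ricci q (rsubmx v).
Proof.
move=> Uv; rewrite -[RHS]add0r big_split_ord big_ord1; congr (_ + _).
  by apply: big1 => k _; rewrite EMrz mul0r.
apply: eq_bigr => j _; rewrite -[RHS]add0r big_split_ord big_ord1; congr (_ + _).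
  by rewrite curv_z// mulmx0 [X in _ * X]mxE mulr0.
apply: eq_bigr => k _; rewrite EMrr; congr (_ * _).
by rewrite (@curv_rr v k j Uv) /EM /extend_mx mul_extend_mx block_mxEdr.
Qed.

Variable G : 'rV[R]_(1 + n) -> 'M[R]_(1 + n).
Hypothesis GE : forall v, U (rsubmx v) -> G v = block_mx 1%:M 0 0
  (th (rsubmx v) *m diag_mx (\row_a weight a v) *m (th (rsubmx v))^T).

Let gE v : UM v -> G v = tM v *m diag_mx (frame_weights v) *m (tM v)^T.
Proof.
move=> Uv; rewrite GE// /tM /extend_mx /frame_weights diag_mx_row.
rewrite (_ : diag_mx (const_mx 1 : 'rV[R]_1) = 1%:M); last first.
  by apply/matrixP => a b; rewrite !mxE.
rewrite mul_extend_mx tr_block_mx !trmx0 tr_scalar_mx mul_extend_mx.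
by rewrite !mul1r.
Qed.

Lemma frame_metric_extension v : UM v ->
  EM v *m G v *m (EM v)^T = diag_mx (frame_weights v).
Proof.
move=> Uv; rewrite gE// !mulmxA EthM// mul1mx -mulmxA -trmx_mul EthM//.
by rewrite trmx1 mulmx1.
Qed.

Let ricM v q : UM v -> _ := fun Uv => ricci_frame oUM EthM dEM dtM ddtM dA
  derivable_frame_weights frame_weights_neq0 gE A_metric A_torsion q Uv.

(** In the frame, the covariant derivative along d_u acts on the E_a as the constant diagonal matrix
    of p, so only minus the trace of its square survives. *)
Lemma ricci_extension_l v : UM v ->
  (EM v *m ricci G v *m (EM v)^T) z z = - \sum_a p a 0 ^+ 2.
Proof.
move=> Uv; rewrite (ricM z Uv) flat_ricci_z// add0r.
have Azz d : A z v z d = 0.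
  by case: (split_ordP d) => [d0 ->|d' ->]; rewrite ?(ord1 d0) ?Azzz ?Azzr.
have S0 (B : 'I_(1 + n) -> R) : \sum_d A z v z d * B d = 0.
  by apply: big1 => d _; rewrite Azz mul0r.
rewrite big_split_ord big_ord1 -[RHS]add0r; congr (_ + _).
  rewrite (S0 (fun d => A z v d z)) subr0 addr0 subrr add0r.
  by apply: big1 => c _; rewrite tor_zz mul0r.
rewrite -sumrN; apply: eq_bigr => a _.
have -> : frame_derive EM (r a) (fun y => A z y z (r a)) v = 0.
  under eq_fun do rewrite Azzr.
  by rewrite /frame_derive big1// => k _; rewrite derive_cst mulr0.
have -> : frame_derive EM z (fun y => A (r a) y z (r a)) v = 0.
  by under eq_fun do rewrite Arzr; rewrite fdz derive_cst.
have -> : \sum_c frame_torsion EM tM (r a) z c v * A c v z (r a) = 0.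
  by apply: big1 => c _; rewrite tor_rz// mul0r.
rewrite (S0 (fun d => A (r a) v d (r a))) subr0 !add0r; congr (- _).
rewrite big_split_ord big_ord1 /= Arzz mul0r add0r (bigD1 a)//= big1 => [|d da].
  by rewrite Arzr Azrr eqxx mulr1n mulr1 addr0 expr2.
by rewrite Arzr (negbTE da) mulr0 mul0r.
Qed.

Let fdr_rsub c (h : 'rV[R]_n -> R) v :
  frame_derive EM (r c) (fun x => h (rsubmx x)) v = frame_derive E c h (rsubmx v).
Proof. by rewrite fdr; apply: eq_bigr => j _; rewrite derive_rsub_r. Qed.

Let derive_quot_r a b v j : 'D_('e_(r j)) (fun x => weight a x / weight b x) v = 0.
Proof.
rewrite (derive_mulf (@derivable_weight a v (r j))
  (derivableV (weight_neq0 b v) (@derivable_weight b v (r j)))).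
rewrite (deriveV (weight_neq0 b v) (@derivable_weight b v (r j))) !derive_weight_r.
by rewrite scaler0 mul0r mulr0 addr0.
Qed.

Let Aqqa v q a : A (r q) v (r q) (r a) = T q a q v * (weight q v / weight a v).
Proof. by rewrite Arrr Tdiag; field; rewrite weight_neq0. Qed.

Let Aada v d a : A (r a) v (r d) (r a) = T d a a v.
Proof. by rewrite Arrr Tdiag (Tanti a d); field; rewrite weight_neq0. Qed.

Let fd_Aqqa v q a : UM v -> frame_derive EM (r a) (fun x => A (r q) x (r q) (r a)) v =
  frame_derive E a (frame_torsion E th q a q) (rsubmx v) * (weight q v / weight a v).
Proof.
move=> Uv; under eq_fun do rewrite Aqqa.
rewrite fdr mulr_suml; apply: eq_bigr => j _.
rewrite (derive_mulf (@dT q a q v (r j) Uv) (@dquot q a v (r j))) derive_quot_r.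
have -> : 'D_('e_(r j)) (T q a q) v = 'D_('e_j) (frame_torsion E th q a q) (rsubmx v).
  exact (derive_rsub_r (frame_torsion E th q a q) v j).
by rewrite mulr0 addr0 mulrA.
Qed.

Let fd_Aaqa v q a : frame_derive EM (r q) (fun x => A (r a) x (r q) (r a)) v =
  frame_derive E q (frame_torsion E th q a a) (rsubmx v).
Proof.
under eq_fun do rewrite Aada.
exact (fdr_rsub q (frame_torsion E th q a a) v).
Qed.

Let fd_Aqqz v q : frame_derive EM z (fun x => A (r q) x (r q) z) v =
  - (2 * p q 0 ^+ 2 * weight q v).
Proof.
under eq_fun do rewrite Arrz eqxx mulr1 -mulNr.
rewrite fdz (derive_mulf (f := fun=> - p q 0) (derivable_cst _ _ _) (@derivable_weight q v z)).
rewrite derive_cst.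
by rewrite derive_weight_l mul0r add0r; ring.
Qed.

(** Abstracting the point [y] of N and the weights [w] separates the two variables: u occurs on the
    right-hand side through [w] alone. *)
Lemma ricci_extension_r v q y (w : 'I_n -> R) : UM v ->
  rsubmx v = y -> weight^~ v = w ->
  let t c a d := frame_torsion E th c a d y in
  (EM v *m ricci G v *m (EM v)^T) (r q) (r q) =
  flat_ricci q y - p q 0 * (\sum_a p a 0) * w q +
  \sum_a (frame_derive E a (frame_torsion E th q a q) y * (w q / w a)
    - frame_derive E q (frame_torsion E th q a a) y
    + \sum_c t a q c * (2^-1 * (t c a q * (w q / w a) + t q a c * (w c / w a) - t c q a))
    + \sum_d t q d q * (w q / w d) * t d a a
    - \sum_d 2^-1 * (t a d q * (w q / w d) + t q d a * (w a / w d) - t a q d)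
       * (2^-1 * (t q a d * (w d / w a) + t d a q * (w q / w a) - t q d a))).
Proof.
move=> Uv <- <- t {y w}; set w := weight^~ v.
rewrite (ricM (r q) Uv) flat_ricci_r//.
rewrite -[RHS]addrA; congr (_ + _).
rewrite big_split_ord big_ord1 /=.
rewrite fd_Aqqz.
have -> : frame_derive EM (r q) (fun x => A z x (r q) z) v = 0.
  under eq_fun do rewrite Azrz.
  by rewrite /frame_derive big1// => k _; rewrite derive_cst mulr0.
have -> : \sum_c frame_torsion EM tM z (r q) c v * A c v (r q) z = 0.
  by apply: big1 => c _; rewrite tor_zr// mul0r.
have -> : \sum_d A (r q) v (r q) d * A z v d z = 0.
  apply: big1 => d _; case: (split_ordP d) => [d0 ->|d' ->].
    by rewrite (ord1 d0) Azzz mulr0.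
  by rewrite Azrz mulr0.
have -> : \sum_d A z v (r q) d * A (r q) v d z = - (p q 0 ^+ 2 * w q).
  rewrite big_split_ord big_ord1 /= Azrz mul0r add0r (bigD1 q)//= big1 => [|d dq].
    by rewrite Azrr Arrz !eqxx !mulr1n /w; ring.
  by rewrite Arrz (negbTE dq) !mulr0.
(* The term in Tr D is distributed over the trace. The index d_u contributes - 2 p_q^2 w_q + p_q^2
   w_q, and each index a contributes - p_q p_a w_q, with a correction p_q^2 w_q at a = q. *)
have -> : - (p q 0 * (\sum_a p a 0) * w q) =
   - (p q 0 ^+ 2 * w q) + \sum_a (- (p q 0 * w q * p a 0) + p q 0 ^+ 2 * w q * (a == q)%:R).
  rewrite big_split /= sumrN -mulr_sumr (bigD1 (F := fun a => p q 0 ^+ 2 * w q * (a == q)%:R) q)//=.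
  rewrite [\sum_(i | i != q) _]big1 ?eqxx ?mulr1 ?addr0 => [|d dq].
    by ring.
  by rewrite (negbTE dq) mulr0.
rewrite -[RHS]addrA; congr (_ + _); first by rewrite /w; ring.
rewrite -big_split; apply: eq_bigr => a _ /=.
rewrite fd_Aqqa// fd_Aaqa.
rewrite big_split_ord big_ord1 /= tor_rrz// mul0r add0r.
rewrite [\sum_(d < 1 + n) A (r q) v (r q) d * _]big_split_ord big_ord1 /= Arrz Arzr !eqxx !mulr1.
rewrite [\sum_(d < 1 + n) A (r a) v (r q) d * _]big_split_ord big_ord1 /= Arrz Arzr.
rewrite (_ : \sum_(i < n) frame_torsion EM tM (r a) (r q) (r i) v * _ = \sum_c t a q c *
   (2^-1 * (t c a q * (w q / w a) + t q a c * (w c / w a) - t c q a))); last first.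
  by apply: eq_bigr => c _; rewrite tor_rrr// Arrr.
rewrite (_ : \sum_(i < n) A (r q) v (r q) (r i) * _ = \sum_d t q d q * (w q / w d) * t d a a); last first.
  by apply: eq_bigr => d _; rewrite Aqqa Aada.
rewrite (_ : \sum_(i < n) A (r a) v (r q) (r i) * _ =
  \sum_d 2^-1 * (t a d q * (w q / w d) + t q d a * (w a / w d) - t a q d)
       * (2^-1 * (t q a d * (w d / w a) + t d a q * (w q / w a) - t q d a))); last first.
  by apply: eq_bigr => d _; rewrite !Arrr.
rewrite /w (eq_sym q a); case: (eqVneq a q) => [->|_] /=; rewrite ?mulr1n ?mulr0n; ring.
Qed.

End ExtensionRicci.

(** * Exponential polynomials *)

Section ExponentialSums.
Context {R : realType}.
Implicit Types (F G : R -> R) (s : seq (R * R)).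

Definition expsum s (u : R) : R := \sum_(x <- s) x.1 * expR (u * x.2).

(* [k] is the coefficient of the frequency 0 in the exponential polynomial [F]. *)
Definition has_mean F (k : R) := exists2 s, F =1 expsum s &
  k = \sum_(x <- s | x.2 == 0) x.1.

(* The operator F |-> F(u + 1) - e^w F(u) kills e^(w u). *)
Lemma expsum_cst_eq0 s c : all (fun x => x.2 != 0) s ->
  (forall u, expsum s u = c) -> c = 0.
Proof.
(* The induction is on the length: the hypothesis is applied not to the tail but to [s'], which has
   the same length and modified coefficients. *)
elim: {s}(size s) {-2}s (erefl (size s)) c => [|m IH] [|[a w] s]//=.
  by move=> _ c _ h; rewrite -(h 0) /expsum big_nil.
move=> [sm] c /andP[w0 s0] h.
pose s' := [seq (x.1 * (expR x.2 - expR w), x.2) | x <- s].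
have : c * (1 - expR w) = 0.
  apply: (IH s'); rewrite ?size_map//; first by rewrite all_map.
  move=> u; have := h (u + 1); have := h u.
  rewrite /expsum !big_cons /= big_map => h0 h1.
  transitivity (\sum_(x <- s) x.1 * expR ((u + 1) * x.2) - expR w * \sum_(x <- s) x.1 * expR (u * x.2)).
    rewrite mulr_sumr -sumrB; apply: eq_bigr => x _ /=.
    by rewrite mulrDl mul1r expRD; ring.
  have -> : \sum_(x <- s) x.1 * expR (u * x.2) = c - a * expR (u * w) by rewrite -h0; ring.
  have -> : \sum_(x <- s) x.1 * expR ((u + 1) * x.2) = c - a * expR ((u + 1) * w).
    by rewrite -h1; ring.
  by rewrite mulrDl mul1r expRD; ring.
move/eqP; rewrite mulf_eq0 => /orP[/eqP//|].
rewrite subr_eq0 => /eqP e1; move: w0.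
by rewrite -(expRK w) -e1 ln1 eqxx.
Qed.

(** [has_mean] is a relation, since an exponential polynomial may be written in several ways. For a
    constant function the coefficient is forced: the terms of nonzero frequency sum to a constant,
    which is zero by [expsum_cst_eq0]. *)
Lemma has_mean_cst c k : has_mean (fun=> c) k -> c = k.
Proof.
move=> [s Fs ->]; apply/eqP; rewrite -subr_eq0; apply/eqP.
apply: (@expsum_cst_eq0 [seq x <- s | x.2 != 0]); first exact: filter_all.
move=> u; rewrite {1}(Fs u) /expsum big_filter [in RHS](bigID (fun x => x.2 == 0)) /=.
rewrite [X in _ = X + _ - _](eq_bigr (fun x => x.1)) => [|x /eqP ->].
  by rewrite addrAC subrr add0r.
by rewrite mulr0 expR0 mulr1.
Qed.

Lemma has_mean_exp a w : has_mean (fun u => a * expR (u * w)) ((w == 0)%:R * a).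
Proof.
exists [:: (a, w)]; first by move=> u; rewrite /expsum big_seq1.
by rewrite big_mkcond big_seq1 /=; case: eqP => _; rewrite ?mul1r ?mul0r.
Qed.

Lemma has_mean_exp0 a w : w != 0 -> has_mean (fun u => a * expR (u * w)) 0.
Proof. by move=> w0; have := has_mean_exp a w; rewrite (negbTE w0) mul0r. Qed.

Lemma has_meanD F G k l : has_mean F k -> has_mean G l ->
  has_mean (fun u => F u + G u) (k + l).
Proof.
move=> [s Fs ->] [t Gt ->]; exists (s ++ t); last by rewrite big_cat.
by move=> u; rewrite Fs Gt /expsum big_cat.
Qed.

Lemma has_mean_sum (I : finType) (F : I -> R -> R) (k : I -> R) :
  (forall i, has_mean (F i) (k i)) -> has_mean (fun u => \sum_i F i u) (\sum_i k i).
Proof.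
move=> h; elim: (index_enum I) => [|i s [t Ft kt]].
  exists [::]; last by rewrite !big_nil.
  by move=> u; rewrite /expsum !big_nil.
have [t' Ft' kt'] := h i.
exists (t' ++ t); last by rewrite big_cons big_cat kt kt'.
by move=> u; rewrite big_cons Ft Ft' /expsum big_cat.
Qed.

Lemma eq_has_mean F G k : F =1 G -> has_mean F k -> has_mean G k.
Proof. by move=> FG [s Fs ->]; exists s => // u; rewrite -FG. Qed.

End ExponentialSums.

(** * The constant term of the Einstein equation *)

Section WeightZero.
Context {R : realType} {n : nat}.
Variables (p : 'cV[R]_n) (t : 'I_n -> 'I_n -> 'I_n -> R).
Hypothesis p_neq0 : forall a, p a 0 != 0.
Hypothesis t_anti : forall a b d, t a b d = - t b a d.

(* The two families of frequencies p_b - p_q - p_a contributed by the last sum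
   cancel after exchanging the summation indices. *)
Lemma weight_zero_part (q : 'I_n) (c fl S : R) (X Y : 'I_n -> R) :
  (forall (u : R) (w : 'I_n -> R), (forall a, w a = expR (2 * u * p a 0)) ->
    c * w q = fl - p q 0 * S * w q +
    \sum_a (X a * (w q / w a) - Y a
    + \sum_c t a q c * (2^-1 * (t c a q * (w q / w a) + t q a c * (w c / w a) - t c q a))
    + \sum_d t q d q * (w q / w d) * t d a a
    - \sum_d 2^-1 * (t a d q * (w q / w d) + t q d a * (w a / w d) - t a q d)
       * (2^-1 * (t q a d * (w d / w a) + t d a q * (w q / w a) - t q d a)))) ->
  c + p q 0 * S =
    - 2^-1 * (\sum_a \sum_b (p b 0 == p q 0 + p a 0)%:R * t q a b ^+ 2)
    + 4^-1 * (\sum_a \sum_b (p q 0 == p a 0 + p b 0)%:R * t a b q ^+ 2).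
Proof.
move=> h.
have N0 a : - (2 * p a 0) != 0 by rewrite oppr_eq0 mulf_neq0.
pose lam a b d := 2 * (p d 0 - p a 0 - p b 0).
have lam0 a b d : (lam a b d == 0) = (p d 0 == p a 0 + p b 0).
  by rewrite /lam mulf_eq0 pnatr_eq0 /= -addrA -opprD subr_eq0.
pose e (x u : R) := expR (u * x).
(* [F] is the right-hand side divided by [w q] and expanded: 1 / w_a has frequency - 2 p_a, never
   zero, and w_d / (w_a w_b) has frequency [lam a b d], zero exactly when p_d = p_a + p_b. The
   latter always come with squares, thanks to the antisymmetry of [t]. *)
pose F u := fl * e (- (2 * p q 0)) u +
  \sum_a (X a * e (- (2 * p a 0)) u + (- Y a) * e (- (2 * p q 0)) u
  + \sum_b (2^-1 * t a q b * t b a q * e (- (2 * p a 0)) u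
          + - 2^-1 * t q a b ^+ 2 * e (lam q a b) u
          + - 2^-1 * t a q b * t b q a * e (- (2 * p q 0)) u)
  + \sum_d (t q d q * t d a a * e (- (2 * p d 0)) u)
  + \sum_d ((- 4^-1 * t a d q * t q a d + 4^-1 * t a q d * t d a q) * e (- (2 * p a 0)) u
     + 4^-1 * t a d q ^+ 2 * e (lam a d q) u
     + (4^-1 * t a d q * t q d a - 4^-1 * t q d a * t d a q) * e (- (2 * p d 0)) u
     + (- 4^-1 * t q d a * t q a d - 4^-1 * t a q d * t q d a) * e (- (2 * p q 0)) u
     + 4^-1 * t q d a ^+ 2 * e (lam q d a) u
     + - 4^-1 * t q a d ^+ 2 * e (lam q a d) u)).
have hF : has_mean F (0 + \sum_a (0 + 0
  + \sum_b (0 + (lam q a b == 0)%:R * (- 2^-1 * t q a b ^+ 2) + 0)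
  + \sum_(d < n) 0
  + \sum_d (0 + (lam a d q == 0)%:R * (4^-1 * t a d q ^+ 2) + 0 + 0
     + (lam q d a == 0)%:R * (4^-1 * t q d a ^+ 2)
     + (lam q a d == 0)%:R * (- 4^-1 * t q a d ^+ 2)))).
  rewrite /F /e.
  by do ![apply: has_meanD | apply: has_mean_sum => ? | apply: has_mean_exp0; exact: N0
    | exact: has_mean_exp].
have cF : (fun=> c + p q 0 * S) =1 F.
  move=> u; pose w a := expR (2 * u * p a 0).
  have w0 a : w a != 0 by exact/lt0r_neq0/expR_gt0.
  have /(congr1 (fun x => x / w q)) := h u w (fun=> erefl).
  rewrite mulfK//; set Z := \sum_a _ => ceq.
  have eN a : e (- (2 * p a 0)) u = (w a)^-1.
    by rewrite /e /w -expRN; congr expR; ring.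
  have el a b d : e (lam a b d) u = w d / w a / w b.
    by rewrite /e /w /lam -!expRN -!expRD; congr expR; ring.
  transitivity (fl / w q + Z / w q); first by rewrite ceq; field; exact: w0.
  rewrite /F eN /Z; congr (_ + _).
  rewrite mulr_suml; apply: eq_bigr => a _.
  rewrite !eN !mulrDl !mulNr; congr (_ + _ + _ + _).
  - by field; rewrite !w0.
  - rewrite mulr_suml; apply: eq_bigr => b _.
    by rewrite !el (t_anti a q); field; rewrite !w0.
  - rewrite mulr_suml; apply: eq_bigr => b _.
    by rewrite !eN; field; rewrite !w0.
  - rewrite mulr_suml -sumrN; apply: eq_bigr => d _.
    rewrite !eN !el (t_anti a q) (t_anti d a).
    by field; rewrite !w0.
have := has_mean_cst (eq_has_mean (fsym cF) hF) => ->.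
rewrite !mulr_sumr add0r.
rewrite (eq_bigr (fun a => (\sum_b (- 2^-1 * ((p b 0 == p q 0 + p a 0)%:R * t q a b ^+ 2)))
   + \sum_b (4^-1 * ((p q 0 == p a 0 + p b 0)%:R * t a b q ^+ 2))
   + \sum_b (4^-1 * ((p a 0 == p q 0 + p b 0)%:R * t q b a ^+ 2)
     - 4^-1 * ((p b 0 == p q 0 + p a 0)%:R * t q a b ^+ 2)))); last first.
  move=> a _; rewrite big1_eq !add0r addr0 -addrA; congr (_ + _).
    by apply: eq_bigr => b _; rewrite lam0; ring.
  by rewrite -big_split; apply: eq_bigr => b _ /=; rewrite !lam0; ring.
rewrite !big_split /=.
under [X in _ + X]eq_bigr do rewrite sumrB.
rewrite sumrB [X in _ + (X - _)]exchange_big subrr addr0.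
by congr (_ + _); apply: eq_bigr => a _; rewrite mulr_sumr.
Qed.

End WeightZero.

(** * Linear algebra of the spectral vector *)

Section SpectralVector.
Context {R : realType} {n : nat}.
Implicit Types (p v w : 'cV[R]_n) (x : 'I_n * 'I_n * 'I_n) (B : {set 'I_n * 'I_n * 'I_n}).

Definition Fvec x : 'cV[R]_n := fvec R x.1.1 + fvec R x.1.2 - fvec R x.2.

(* The triples (i, j, k) such that f_i + f_j - f_k lies in F and is orthogonal to p. *)
Definition resonances p : {set 'I_n * 'I_n * 'I_n} := [set x |
  [&& x.1.1 != x.1.2, x.2 != x.1.1, x.2 != x.1.2 & p x.2 0 == p x.1.1 0 + p x.1.2 0]].

Lemma dot_fvec i p : dot (fvec R i) p = p i 0.
Proof.
rewrite /dot /fvec mxE (bigD1 i)//= big1 => [|j ji]; first by rewrite !mxE !eqxx mul1r addr0.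
by rewrite !mxE (negbTE ji) mul0r.
Qed.

Lemma dotDl v w p : dot (v + w) p = dot v p + dot w p.
Proof. by rewrite /dot linearD /= mulmxDl mxE. Qed.

Lemma dotZl a v p : dot (a *: v) p = a * dot v p.
Proof. by rewrite /dot linearZ /= -scalemxAl mxE. Qed.

Lemma dotNl v p : dot (- v) p = - dot v p.
Proof. by rewrite -scaleN1r dotZl mulN1r. Qed.

Lemma dotE v p : dot v p = \sum_i v i 0 * p i 0.
Proof. by rewrite /dot mxE; apply: eq_bigr => i _; rewrite mxE. Qed.

Lemma dot_Fvec x p : dot (Fvec x) p = p x.1.1 0 + p x.1.2 0 - p x.2 0.
Proof. by rewrite /Fvec !dotDl dotNl !dot_fvec. Qed.

Lemma Fvec_resonance p x : x \in resonances p -> (@Fset R n `&` perp p) (Fvec x).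
Proof.
rewrite inE => /and4P[ij ki kj /eqP e]; split.
  by exists x.1.1, x.1.2, x.2.
by rewrite /perp /= dot_Fvec e subrr.
Qed.

Section StructureConstants.
Variables (p : 'cV[R]_n) (t : 'I_n -> 'I_n -> 'I_n -> R).
Hypothesis p_neq0 : forall a, p a 0 != 0.
Hypothesis t_anti : forall a b d, t a b d = - t b a d.
Hypothesis t_eq : forall q, - (\sum_a p a 0 ^+ 2) + p q 0 * (\sum_a p a 0) =
    - 2^-1 * (\sum_a \sum_b (p b 0 == p q 0 + p a 0)%:R * t q a b ^+ 2)
    + 4^-1 * (\sum_a \sum_b (p q 0 == p a 0 + p b 0)%:R * t a b q ^+ 2).

(** In coordinate q, a triple counts positively when q is its first or second index and negatively
    when q is its third. Symmetry of the squares in the first two indices doubles the positive part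
    and turns 1/4 into 1/2, as in [t_eq]. The triples left out of [resonances] do not matter: t_iik
    = 0 by antisymmetry, and k = i or k = j would force an eigenvalue to be zero. *)
Lemma resonance_combination :
  (\sum_a p a 0 ^+ 2) *: ones R n - (\sum_a p a 0) *: p =
  \sum_(x in resonances p) (4^-1 * t x.1.1 x.1.2 x.2 ^+ 2) *: Fvec x.
Proof.
pose mu a b k := 4^-1 * ((p k 0 == p a 0 + p b 0)%:R * t a b k ^+ 2).
have mu_sym a b k : mu a b k = mu b a k.
  by rewrite /mu (addrC (p a 0)) (t_anti a b) sqrrN.
apply/colP => q; rewrite summxE.
transitivity (\sum_x mu x.1.1 x.1.2 x.2 * Fvec x q 0); last first.
  rewrite [RHS]big_mkcond /=; apply: eq_bigr => -[[a b] k] _; rewrite /mu inE /=.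
  case: (eqVneq (p k 0) (p a 0 + p b 0)) => [e|_]; last first.
    by rewrite !andbF mul0r mulr0 mul0r.
  rewrite andbT mul1r; case: (eqVneq a b) => [->|_] /=.
    have -> : t b b k = 0.
      by have := t_anti b b k => /eqP; rewrite -subr_eq0 opprK -mulr2n mulrn_eq0 => /eqP.
    by rewrite expr0n mulr0 mul0r.
  have -> : k != a.
    apply: contra (p_neq0 b) => /eqP ka; move: e; rewrite ka => /eqP.
    by rewrite -subr_eq0 opprD addNKr oppr_eq0.
  have -> : k != b.
    apply: contra (p_neq0 a) => /eqP kb; move: e; rewrite kb => /eqP.
    by rewrite -subr_eq0 opprD addrCA subrr addr0 oppr_eq0.
  by rewrite [RHS]mxE.
rewrite -(pair_bigA _ (fun ab k => mu ab.1 ab.2 k * Fvec (ab, k) q 0)) /=.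
rewrite -(pair_bigA _ (fun a b => \sum_k mu a b k * Fvec (a, b, k) q 0)) /=.
have FE a b k : Fvec (a, b, k) q 0 = (q == a)%:R + (q == b)%:R - (q == k)%:R.
  by rewrite !mxE !eqxx !andbT.
have pick (h : 'I_n -> R) : \sum_a h a * (q == a)%:R = h q.
  rewrite (bigD1 q)//= eqxx mulr1 big1 ?addr0// => a aq.
  by rewrite eq_sym (negbTE aq) mulr0.
transitivity (\sum_b \sum_k mu q b k + \sum_a \sum_k mu a q k - \sum_a \sum_b mu a b q); last first.
  rewrite -(pick (fun a => \sum_b \sum_k mu a b k)) -big_split -sumrB /=.
  apply: eq_bigr => a _.
  rewrite -(pick (fun b => \sum_k mu a b k)) mulr_suml -big_split -sumrB /=.
  apply: eq_bigr => b _.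
  rewrite -(pick (fun k => mu a b k)) !mulr_suml -big_split -sumrB /=.
  by apply: eq_bigr => k _; rewrite FE; ring.
have -> : \sum_a \sum_k mu a q k = \sum_b \sum_k mu q b k.
  by apply: eq_bigr => a _; apply: eq_bigr => k _; rewrite mu_sym.
have := t_eq q => /(congr1 -%R); rewrite !mxE mulr1 opprD opprK mulrC => ->.
rewrite opprD mulNr opprK; congr (_ - _).
  rewrite !mulr_sumr -big_split /=; apply: eq_bigr => a _.
  rewrite !mulr_sumr -big_split /=; apply: eq_bigr => b _; by rewrite /mu; field.
rewrite !mulr_sumr; apply: eq_bigr => a _.
by rewrite !mulr_sumr.
Qed.

End StructureConstants.

(** If x V^T V = 0, then x V^T has norm zero; a vanishing sum of squares forces x V^T = 0, hence x =
    0. *)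
Lemma gram_unitmx m (V : 'M[R]_(n, m)) : row_free V^T -> V^T *m V \in unitmx.
Proof.
move=> Vfree; rewrite -row_free_unit -kermx_eq0.
set K := kermx _.
have K0 : K *m (V^T *m V) = 0 by exact: mulmx_ker.
have KV : (K *m V^T) *m (K *m V^T)^T = 0.
  by rewrite trmx_mul trmxK mulmxA -(mulmxA K) K0 mul0mx.
rewrite -(mulmx_free_eq0 K Vfree); apply/eqP/matrixP => i j.
move: KV => /(congr1 (fun M : 'M[R]_m => M i i)); rewrite mxE [RHS]mxE => /eqP.
rewrite psumr_eq0 => [|k _]; last by rewrite [X in _ * X]mxE -expr2 sqr_ge0.
move=> /allP/(_ j (mem_index_enum _)) /=.
by rewrite [X in _ * X]mxE -expr2 sqrf_eq0 => /eqP ->; rewrite mxE.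
Qed.

Definition normal_form m (V : 'M[R]_(n, m)) : 'cV[R]_n :=
  ones R n - V *m invmx (V^T *m V) *m ones R m.

(** Write s 1_n - T p = V y and apply V^T. The columns are orthogonal to p, and vectors of F have
    coordinate sum 1, so V^T V y = s 1_m. The Gram matrix is invertible, which determines y and then
    p. For m = 0 the same computation with empty matrices gives p = (s / T) 1_n. *)
Lemma spectral_normal_form p m (V : 'M[R]_(n, m)) (s T : R) (mu : 'I_n * 'I_n * 'I_n -> R) :
  T != 0 -> row_free V^T ->
  (forall j, (@Fset R n `&` perp p) (col j V)) ->
  (forall x, x \in resonances p -> ((Fvec x)^T <= V^T)%MS) ->
  s *: ones R n - T *: p = \sum_(x in resonances p) mu x *: Fvec x ->
  p = (s / T) *: normal_form V.
Proof.
move=> T0 Vfree Vperp Vspan zE.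
have Vp : V^T *m p = 0.
  apply/colP => j; have [_ /= h] := Vperp j.
  rewrite [RHS]mxE -h dotE mxE; apply: eq_bigr => i _; by rewrite !mxE.
have V1 : V^T *m ones R n = ones R m.
  apply/colP => j; have [[a [b [k [_ _ _ e]]]] _] := Vperp j.
  rewrite [RHS]mxE; transitivity (dot (col j V) (ones R n)).
    by rewrite dotE mxE; apply: eq_bigr => i _; rewrite !mxE.
  by rewrite e !dotDl dotNl !dot_fvec !mxE addrK.
have [y zy] : exists y, s *: ones R n - T *: p = V *m y.
  have /submxP[y yE] : ((s *: ones R n - T *: p)^T <= V^T)%MS.
    rewrite zE raddf_sum /=; apply: summx_sub => x xR; rewrite linearZ /=.
    exact/scalemx_sub/Vspan.
  by exists y^T; rewrite -[LHS]trmxK yE trmx_mul trmxK.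
have yE : y = s *: (invmx (V^T *m V) *m ones R m).
  have : V^T *m V *m y = s *: ones R m.
    by rewrite -mulmxA -zy mulmxBr -!scalemxAr Vp V1 scaler0 subr0.
  move=> /(congr1 (fun M => invmx (V^T *m V) *m M)).
  by rewrite mulKmx ?gram_unitmx// -scalemxAr.
have -> : p = T^-1 *: (s *: ones R n - V *m y).
  by rewrite -zy opprB addrCA subrr addr0 scalerA mulVf// scale1r.
by rewrite yE -scalemxAr mulmxA -scalerBr scalerA mulrC.
Qed.

(** A resonance vector outside the span could be appended to V as one more independent column.
    Maximality would make it one of the columns of V after all. *)
Lemma maximal_span p m (V : 'M[R]_(n, m)) :
  maximal_independent_columns_in (@Fset R n `&` perp p) V ->
  forall x, x \in resonances p -> ((Fvec x)^T <= V^T)%MS.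
Proof.
move=> [[Vin Vfree] Vmax] x xR; apply: contraT => nspan.
pose V' : 'M[R]_(n, m + 1) := row_mx V (Fvec x).
have V'l j : col (lshift 1 j) V' = col j V by rewrite colKl.
have V'r j : col (rshift m j) V' = Fvec x.
  by rewrite colKr; apply/colP => i; rewrite mxE (ord1 j).
have ind : independent_columns_in (@Fset R n `&` perp p) V'.
  split=> [j|].
    case: (split_ordP j) => [k ->|k ->]; first by rewrite V'l.
    by rewrite V'r; exact: Fvec_resonance.
  rewrite -kermx_eq0; apply/rowV0P => u /sub_kermxP.
  rewrite tr_row_mx -[u]hsubmxK mul_row_col; set ul := lsubmx u; set ur := rsubmx u.
  have [ur0|ur0] := eqVneq (ur 0 0) 0.
    have -> : ur = 0 by apply/matrixP => a b; rewrite (ord1 a) (ord1 b) ur0 mxE.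
    by rewrite mul0mx addr0 => /eqP; rewrite mulmx_free_eq0// => /eqP ->; rewrite row_mx0.
  rewrite [ur]mx11_scalar mul_scalar_mx => /eqP; rewrite addrC addr_eq0 => /eqP e.
  exfalso; move/negP: nspan; apply.
  rewrite -(scale1r (Fvec x)^T) -(mulVf ur0) -scalerA e scalerN -scaleNr scalemx_sub//.
  exact: submxMl.
have /(Vmax _ _ ind) e : [set col j V | j in [set: 'I_m]] `<=` [set col j V' | j in [set: 'I_(m + 1)]].
  by move=> _ [j _ <-]; exists (lshift 1 j).
have : [set col j V' | j in [set: 'I_(m + 1)]] (Fvec x) by exists (rshift m ord0).
rewrite e => -[j _ jE]; move: nspan; rewrite -jE tr_col.
by rewrite row_sub.
Qed.

Definition resonance_mx (B : {set 'I_n * 'I_n * 'I_n}) : 'M[R]_(#|B|, n) :=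
  \matrix_(i < #|B|) (Fvec (enum_val i))^T.

(** A basis of the span chosen from the set of triples [B] alone, without reference to p. As [B]
    ranges over a finite type, only finitely many normal forms arise. *)
Definition resonance_basis (B : {set 'I_n * 'I_n * 'I_n}) :=
  (rowsub (maxrankfun (resonance_mx B)) (resonance_mx B))^T.

Lemma resonance_basis_free B : row_free (resonance_basis B)^T.
Proof. by rewrite trmxK; exact: maxrowsub_free. Qed.

Lemma col_resonance_basis B j : exists2 x, x \in B & col j (resonance_basis B) = Fvec x.
Proof.
exists (enum_val (maxrankfun (resonance_mx B) j)); first exact: enum_valP.
by rewrite -tr_row row_rowsub rowK trmxK.
Qed.

Lemma resonance_basis_span B x : x \in B -> ((Fvec x)^T <= (resonance_basis B)^T)%MS.
Proof.
move=> xB; rewrite trmxK eq_maxrowsub.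
have -> : (Fvec x)^T = row (enum_rank_in xB x) (resonance_mx B) by rewrite rowK enum_rankK_in.
exact: row_sub.
Qed.

Lemma det_int m (M : 'M[R]_m) : (forall i j, M i j \is a Num.int) -> \det M \is a Num.int.
Proof.
move=> Mi; rewrite /determinant rpred_sum// => s _; rewrite rpredM ?rpred_prod//.
by rewrite rpredX// rpredN rpred1.
Qed.

(** The multiplier is det(V^T V): it replaces the inverse of the Gram matrix by its adjugate, whose
    entries are integers. *)
Lemma normal_form_int m (V : 'M[R]_(n, m)) : row_free V^T ->
  (forall i j, V i j \is a Num.int) ->
  exists2 c : R, c != 0 & forall k, c * normal_form V k 0 \is a Num.int.
Proof.
move=> Vfree Vi; have u := gram_unitmx Vfree.
have Gi i j : (V^T *m V) i j \is a Num.int.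
  by rewrite mxE rpred_sum// => k _; rewrite mxE rpredM.
exists (\det (V^T *m V)); first by rewrite -unitfE -unitmxE.
move=> k; have -> : \det (V^T *m V) * normal_form V k 0 =
    \det (V^T *m V) - (V *m \adj (V^T *m V) *m ones R m) k 0.
  rewrite /normal_form /invmx u -scalemxAr -scalemxAl !mxE mulrBr mulr1 mulrA.
  by rewrite mulfV ?mul1r// -unitfE -unitmxE.
rewrite rpredB ?det_int// mxE rpred_sum// => j _; rewrite [X in _ * X]mxE mulr1.
rewrite mxE rpred_sum// => i _; rewrite rpredM// mxE /cofactor rpredM//.
  by rewrite rpredX// rpredN rpred1.
by apply: det_int => a b; rewrite !mxE rpred_sum// => l _; rewrite mxE rpredM.
Qed.

Lemma resonance_basis_int B i j : resonance_basis B i j \is a Num.int.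
Proof.
have [x _ e] := col_resonance_basis j.
have -> : resonance_basis B i j = Fvec x i 0 by rewrite -e; symmetry; exact: mxE.
by rewrite !mxE rpredB ?rpredD// rpred_nat.
Qed.

End SpectralVector.

(** * Smooth eigenframes *)

Section TwiceDifferentiable.
Context {R : realType} {n : nat}.
Variables (U : set 'rV[R]_n).
Hypothesis oU : open U.
Implicit Types (f g : 'rV[R]_n -> R).

(** The regularity that the frame computations consume. It follows from [smooth_on] and is preserved
    by the algebraic operations, inverses and square roots of Gram-Schmidt. *)
Definition twice_diff f := forall y, U y ->
  differentiable f y /\ forall i j, derivable ('D_('e_i) f) y 'e_j.

Let dd f y i : twice_diff f -> U y -> derivable f y 'e_i.
Proof. by move=> h Uy; apply: diff_derivable; have [] := h y Uy. Qed.

Let d2 f y i j : twice_diff f -> U y -> derivable ('D_('e_i) f) y 'e_j.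
Proof. by move=> h Uy; have [_] := h y Uy; apply. Qed.

Lemma smooth_twice_diff f : smooth_on U f -> twice_diff f.
Proof.
move=> sf y Uy; split; first exact: (sf [::] y Uy).
by move=> i j; apply: diff_derivable; exact: (sf [:: i] y Uy).
Qed.

Lemma twice_diff_cst c : twice_diff (fun=> c).
Proof.
move=> y _; split; first exact: differentiable_cst.
move=> i j; rewrite (_ : 'D_('e_i) (fun=> c) = cst 0); first exact: derivable_cst.
by apply/funext => z; rewrite derive_cst.
Qed.

Lemma twice_diffD f g : twice_diff f -> twice_diff g -> twice_diff (fun y => f y + g y).
Proof.
move=> hf hg y Uy; split.
  by apply: differentiableD; [have [] := hf y Uy|have [] := hg y Uy].
move=> i j.
refine (eq_open_derivable (f := fun z => 'D_('e_i) f z + 'D_('e_i) g z) oU Uy _ _).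
  by move=> z Uz; rewrite (deriveD (@dd f z i hf Uz) (@dd g z i hg Uz)).
exact (derivableD (@d2 f y i j hf Uy) (@d2 g y i j hg Uy)).
Qed.

Lemma twice_diffM f g : twice_diff f -> twice_diff g -> twice_diff (fun y => f y * g y).
Proof.
move=> hf hg y Uy; split.
  by apply: differentiableM; [have [] := hf y Uy|have [] := hg y Uy].
move=> i j.
refine (eq_open_derivable (f := fun z => ('D_('e_i) f z : R) * g z + f z * 'D_('e_i) g z) oU Uy _ _).
  by move=> z Uz; rewrite (derive_mulf (@dd f z i hf Uz) (@dd g z i hg Uz)).
exact (derivableD (derivable_mulf (@d2 f y i j hf Uy) (@dd g y j hg Uy))
  (derivable_mulf (@dd f y j hf Uy) (@d2 g y i j hg Uy))).
Qed.

Lemma twice_diffV f : (forall y, U y -> f y != 0) -> twice_diff f ->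
  twice_diff (fun y => (f y)^-1).
Proof.
move=> f0 hf y Uy; split.
  by apply: differentiableV; [have [] := hf y Uy|exact: f0].
move=> i j.
refine (eq_open_derivable (f := fun z => - ((f z)^-1 * (f z)^-1) * ('D_('e_i) f z : R)) oU Uy _ _).
  move=> z Uz; rewrite (deriveV (f0 z Uz) (@dd f z i hf Uz)).
  by rewrite expr2 invfM.
have dV := derivableV (f0 y Uy) (@dd f y j hf Uy).
exact (derivable_mulf (derivableN (derivable_mulf dV dV)) (@d2 f y i j hf Uy)).
Qed.

(** Restriction to a line reduces a directional derivative to one variable, where the chain rule for
    the square root applies. *)
Lemma derive_lineE f x v : 'D_v f x = 'D_1 (fun h : R => f (h *: v + x)) 0.
Proof.
rewrite /derive.
suff -> : (fun h => h^-1 *: ((f \o shift x) (h *: v) - f x)) =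
  (fun h : R => h^-1 *: (((fun h : R => f (h *: v + x)) \o shift 0) (h *: 1) - f (0 *: v + x))) by [].
by apply/funext => h /=; rewrite addr0 scale0r add0r [_%:A]mulr1.
Qed.

Lemma derive_sqrt_comp f x v : 0 < f x -> derivable f x v ->
  'D_v (fun y => Num.sqrt (f y)) x = (2 * Num.sqrt (f x))^-1 * 'D_v f x.
Proof.
move=> f0 /derivable1P df.
rewrite (derive_lineE f) (derive_lineE (fun y => Num.sqrt (f y))).
have h0 : f (0 *: v + x) = f x by rewrite scale0r add0r.
have := is_derive1_sqrt f0; rewrite -{1}h0 => ds.
have := @is_derive1_comp R Num.sqrt (fun h => f (h *: v + x)) 0 _ _ ds (derivableP df).
by move=> d; rewrite derive_val.
Qed.

Lemma twice_diff_sqrt f : (forall y, U y -> 0 < f y) -> twice_diff f ->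
  twice_diff (fun y => Num.sqrt (f y)).
Proof.
move=> f0 hf.
have diffs y : U y -> differentiable (fun y => Num.sqrt (f y)) y.
  move=> Uy; apply: differentiable_comp; first by have [] := hf y Uy.
  by apply/derivable1_diffP; have [] := is_derive1_sqrt (f0 y Uy).
move=> y Uy; split; first exact: diffs.
move=> i j.
refine (eq_open_derivable (f := fun z => (2 * Num.sqrt (f z))^-1 * ('D_('e_i) f z : R)) oU Uy _ _).
  by move=> z Uz; rewrite (derive_sqrt_comp (f0 z Uz) (@dd f z i hf Uz)).
have s0 : 2 * Num.sqrt (f y) != 0 by rewrite mulf_neq0// gt_eqF// sqrtr_gt0 f0.
exact (derivable_mulf (derivableV (f := fun z => 2 * Num.sqrt (f z)) s0
  (derivable_mulf (derivable_cst (2 : R) _ _) (diff_derivable (diffs y Uy)))) (@d2 f y i j hf Uy)).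
Qed.

Lemma twice_diff_sum (I : Type) (r : seq I) (P : pred I) (F : I -> 'rV[R]_n -> R) :
  (forall i, twice_diff (F i)) -> twice_diff (fun y => \sum_(i <- r | P i) F i y).
Proof.
move=> hF; rewrite (_ : (fun _ => _) = \sum_(i <- r | P i) F i); last first.
  by apply/funext => y; rewrite fct_sumE.
by elim/big_ind : _ => [|f g|i _]; [exact: twice_diff_cst|exact: twice_diffD|exact: hF].
Qed.

Lemma twice_diff_prod (I : Type) (r : seq I) (P : pred I) (F : I -> 'rV[R]_n -> R) :
  (forall i, twice_diff (F i)) -> twice_diff (fun y => \prod_(i <- r | P i) F i y).
Proof.
move=> hF; rewrite (_ : (fun _ => _) = \prod_(i <- r | P i) F i); last first.
  by apply/funext => y; rewrite fct_prodE.
by elim/big_ind : _ => [|f g|i _]; [exact: twice_diff_cst|exact: twice_diffM|exact: hF].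
Qed.

Definition twice_diff_mx m k (M : 'rV[R]_n -> 'M[R]_(m, k)) :=
  forall i j, twice_diff (fun y => M y i j).

Lemma eq_twice_diff f g : f =1 g -> twice_diff f -> twice_diff g.
Proof. by move=> /funext ->. Qed.

Lemma twice_diff_mulmx m k l (M : 'rV[R]_n -> 'M[R]_(m, k)) (N : 'rV[R]_n -> 'M[R]_(k, l)) :
  twice_diff_mx M -> twice_diff_mx N -> twice_diff_mx (fun y => M y *m N y).
Proof.
move=> hM hN i j; apply: (@eq_twice_diff (fun y => \sum_a M y i a * N y a j)).
  by move=> y; rewrite mxE.
by apply: twice_diff_sum => a; exact: twice_diffM.
Qed.

Lemma twice_diff_trmx m k (M : 'rV[R]_n -> 'M[R]_(m, k)) :
  twice_diff_mx M -> twice_diff_mx (fun y => (M y)^T).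
Proof.
by move=> hM i j; apply: (@eq_twice_diff (fun y => M y j i)) => // y; rewrite mxE.
Qed.

Lemma twice_diff_det m (M : 'rV[R]_n -> 'M[R]_m) :
  twice_diff_mx M -> twice_diff (fun y => \det (M y)).
Proof.
move=> hM; apply: twice_diff_sum => s; apply: twice_diffM; first exact: twice_diff_cst.
exact: twice_diff_prod.
Qed.

Lemma twice_diff_mx_derivable m k (M : 'rV[R]_n -> 'M[R]_(m, k)) : twice_diff_mx M ->
  forall y, U y -> forall i, derivable M y 'e_i.
Proof. by move=> hM y Uy i; apply/derivable_mxP => a b; exact: dd. Qed.

Lemma twice_diff_mx_derivable2 m k (M : 'rV[R]_n -> 'M[R]_(m, k)) : twice_diff_mx M ->
  forall y, U y -> forall i j, derivable ('D_('e_i) M) y 'e_j.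
Proof.
move=> hM y Uy i j; apply/derivable_mxP => a b.
refine (eq_open_derivable (f := 'D_('e_i) (fun y => M y a b)) oU Uy _ _).
  by move=> z Uz; rewrite (derive_mxE a b (@twice_diff_mx_derivable _ _ _ hM z Uz i)).
exact: d2.
Qed.

End TwiceDifferentiable.

(** * Diagonalization of a g-symmetric endomorphism at a point *)

Section SymmetricDiagonalization.
Context {R : realType} {n' : nat}.
Local Notation n := n'.+1.
Variables (D g : 'M[R]_n) (p : 'cV[R]_n).
Hypothesis g_pos : forall v : 'rV[R]_n, v != 0 -> 0 < (v *m g *m v^T) 0 0.
Hypothesis Dg : D *m g = g *m D^T.
Hypothesis D_spec : char_poly D = \prod_(k < n) ('X - (p k 0)%:P).

Definition spectrum (q : 'cV[R]_n) : seq R := [seq q k 0 | k <- enum 'I_n].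

Lemma gram_eq0 m (N : 'M[R]_(m, n)) : N *m g *m N^T = 0 -> N = 0.
Proof.
move=> N0; apply/row_matrixP => i; rewrite row0; apply/eqP; apply: contraT => /g_pos.
have -> : (row i N *m g *m (row i N)^T) 0 0 = (N *m g *m N^T) i i.
  by rewrite -row_mul tr_row !mxE; apply: eq_bigr => k _; rewrite !mxE.
by rewrite N0 mxE ltxx.
Qed.

(** Self-adjointness moves one factor D - a across [g]: the g-Gram matrix of M (D - a) equals M (D -
    a)^2 g M^T = 0, and [g] is positive definite. *)
Lemma square_annihilator m (M : 'M[R]_(m, n)) a :
  M *m (D - a%:M) *m (D - a%:M) = 0 -> M *m (D - a%:M) = 0.
Proof.
move=> M0; apply: gram_eq0.
have ga : g *m (D - a%:M)^T = (D - a%:M) *m g.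
  rewrite linearB /= tr_scalar_mx mulmxBr mulmxBl Dg.
  by rewrite mul_mx_scalar mul_scalar_mx.
by rewrite trmx_mul mulmxA -(mulmxA _ g) ga !mulmxA M0 !mul0mx.
Qed.

(** Repeated linear factors are removed one at a time by [square_annihilator]; [r] accumulates the
    factors already passed. *)
Lemma undup_annihilator s (r : {poly R}) :
  horner_mx D (r * \prod_(x <- s) ('X - x%:P)) = 0 ->
  horner_mx D (r * \prod_(x <- undup s) ('X - x%:P)) = 0.
Proof.
elim: s r => [|x s IH] r //=; rewrite big_cons mulrA => /IH h.
case: ifP => xs; last by rewrite big_cons mulrA.
rewrite -mem_undup in xs; rewrite (perm_big _ (perm_to_rem xs)) big_cons in h *.
set t := \prod_(_ <- _) _ in h *.
have hX : horner_mx D ('X - x%:P) = D - x%:M.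
  by rewrite rmorphB /= horner_mx_X horner_mx_C.
have -> : r * (('X - x%:P) * t) = r * t * ('X - x%:P) by ring.
rewrite rmorphM /= hX -mulmxE.
apply: square_annihilator; rewrite mulmxE -hX -!rmorphM /=.
have -> : r * t * ('X - x%:P) * ('X - x%:P) = r * ('X - x%:P) * (('X - x%:P) * t) by ring.
exact: h.
Qed.

Lemma spectrum_annihilator :
  horner_mx D (\prod_(x <- undup (spectrum p)) ('X - x%:P)) = 0.
Proof.
rewrite -[\prod_(_ <- _) _]mul1r; apply: undup_annihilator.
by rewrite mul1r /spectrum big_map big_enum -D_spec Cayley_Hamilton.
Qed.

Lemma char_poly_simmx (A B P : 'M[R]_n) : P \in unitmx -> P *m A = B *m P ->
  char_poly A = char_poly B.
Proof.
move=> Pu PA; pose Q := map_mx polyC P.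
have : Q *m char_poly_mx A = char_poly_mx B *m Q.
  rewrite /char_poly_mx mulmxBr mulmxBl -!map_mxM PA.
  by rewrite mul_mx_scalar mul_scalar_mx.
move=> /(congr1 determinant); rewrite !det_mulmx mulrC => /mulIf; apply.
by rewrite det_map_mx polyC_eq0 -unitfE -unitmxE.
Qed.

(** By Cayley-Hamilton and the removal of repeated factors, D is annihilated by a product of
    distinct linear factors, hence is diagonalizable. *)
Lemma symmetric_eigenbasis :
  exists2 E : 'M[R]_n, E \in unitmx & E *m D = diag_mx p^T *m E.
Proof.
have /diagonalizableP[P Pu /diagonalizable_forPex[d /(simmxP Pu) PD]] :
    exists2 rs, uniq rs & mxminpoly D %| \prod_(x <- rs) ('X - x%:P).
  exists (undup (spectrum p)); first exact: undup_uniq.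
  exact/mxminpoly_min/spectrum_annihilator.
(* The diagonal found so far lists the eigenvalues in an arbitrary order. Comparing characteristic
   polynomials yields the permutation of the rows that restores the order of p. *)
have : perm_eq (spectrum p) [tuple d 0 i | i < n].
  apply: prod_XsubC_eq; rewrite /spectrum big_map big_enum -D_spec.
  rewrite (char_poly_simmx Pu PD) char_poly_trig ?diag_mx_is_trig//.
  rewrite /= big_map big_enum; apply: eq_bigr => i _.
  by rewrite mxE eqxx.
case/tuple_permP => s sE.
have pd k : p k 0 = d 0 (s k).
  have := congr1 (fun t => nth 0 t k) sE.
  rewrite /spectrum (nth_map k) ?size_enum_ord// nth_ord_enum => ->.
  by rewrite -(tnth_nth 0 [tuple tnth [tuple d 0 i | i < n] (s i) | i < n]) !tnth_mktuple.
exists (row_perm s P).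
  by rewrite row_permE unitmx_mul unitmx_perm.
apply/matrixP => i j; rewrite mul_diag_mx [RHS]mxE [p^T 0 i]mxE pd [row_perm s P i j]mxE.
have := congr1 (fun M : 'M[R]_n => M (s i) j) PD; rewrite mul_diag_mx [RHS]mxE => <-; rewrite [LHS]mxE [RHS]mxE.
by apply: eq_bigr => k _; rewrite !mxE.
Qed.

Lemma horner_mx_eigen m (v : 'M[R]_(m, n)) a (r : {poly R}) : v *m D = a *: v ->
  v *m horner_mx D r = r.[a] *: v.
Proof.
move=> va; elim/poly_ind: r => [|r c IH]; first by rewrite rmorph0 mulmx0 horner0 scale0r.
rewrite rmorphD rmorphM /= horner_mx_X horner_mx_C mulmxDr -mulmxE mulmxA IH.
by rewrite -scalemxAl va mul_mx_scalar hornerMXaddC scalerA scalerDl.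
Qed.

End SymmetricDiagonalization.

(** * Eigenframes near a point and their orthonormalization *)

Section EigenFrame.
Context {R : realType} {n' : nat}.
Local Notation n := n'.+1.
Variables (D g : 'rV[R]_n -> 'M[R]_n) (p : 'cV[R]_n).

(* Multiplication by [other_roots a] evaluated at D projects, up to scaling, onto
   the [a]-eigenspace of D. *)
Definition other_roots (a : R) : {poly R} :=
  \prod_(x <- rem a (undup (spectrum p))) ('X - x%:P).

Let mem_spectrum k : p k 0 \in undup (spectrum p).
Proof. by rewrite mem_undup; apply/mapP; exists k; rewrite ?mem_enum. Qed.

Let other_rootsE k :
  \prod_(x <- undup (spectrum p)) ('X - x%:P) = other_roots (p k 0) * ('X - (p k 0)%:P).
Proof. by rewrite (perm_big _ (perm_to_rem (mem_spectrum k))) big_cons mulrC. Qed.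

Let other_roots_neq0 k : (other_roots (p k 0)).[p k 0] != 0.
Proof.
rewrite -rootE root_prod_XsubC mem_rem_uniq ?undup_uniq//.
by rewrite inE eqxx.
Qed.

(** A fixed eigenbasis [E0] at one point is projected to the eigenspaces of D at nearby points. The
    result is polynomial in D, hence as regular as D. *)
Definition spread_frame (E0 : 'M[R]_n) y : 'M[R]_n :=
  \matrix_k (row k E0 *m horner_mx (D y) (other_roots (p k 0))).

Lemma twice_diff_horner (U : set 'rV[R]_n) (s : seq R) : open U -> twice_diff_mx U D ->
  twice_diff_mx U (fun y => horner_mx (D y) (\prod_(x <- s) ('X - x%:P))).
Proof.
move=> oU hD; elim: s => [|x s IH].
  move=> i j; apply: (@eq_twice_diff _ _ _ (fun=> (1 : 'M[R]_n) i j)).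
    by move=> y; rewrite big_nil rmorph1.
  exact: twice_diff_cst.
move=> i j; apply: (@eq_twice_diff _ _ _ (fun y =>
    ((D y - x%:M) *m horner_mx (D y) (\prod_(x <- s) ('X - x%:P))) i j)).
  by move=> y; rewrite big_cons rmorphM /= rmorphB /= horner_mx_X horner_mx_C mulmxE.
have hB : twice_diff_mx U (fun y => D y - x%:M).
  move=> a b; apply: (@eq_twice_diff _ _ _ (fun y => D y a b + (- (x *+ (a == b))))).
    by move=> y; rewrite !mxE.
  exact (twice_diffD oU (hD a b) (@twice_diff_cst _ _ U (- (x *+ (a == b))))).
exact (twice_diff_mulmx oU hB IH i j).
Qed.

Lemma twice_diff_spread_frame (U : set 'rV[R]_n) E0 : open U -> twice_diff_mx U D ->
  twice_diff_mx U (spread_frame E0).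
Proof.
move=> oU hD k j; apply: (@eq_twice_diff _ _ _ (fun y =>
    (row k E0 *m horner_mx (D y) (other_roots (p k 0))) 0 j)).
  by move=> y; rewrite [RHS]mxE.
have hr : twice_diff_mx U (fun=> row k E0) by move=> a b; exact: twice_diff_cst.
exact (twice_diff_mulmx oU hr (twice_diff_horner _ oU hD) 0 j).
Qed.

Let row_diag_mul (d : 'rV[R]_n) (M : 'M[R]_n) k : row k (diag_mx d *m M) = d 0 k *: row k M.
Proof. by apply/rowP => j; rewrite mxE mul_diag_mx !mxE. Qed.

Lemma spread_frame_eigen E0 y :
  horner_mx (D y) (\prod_(x <- undup (spectrum p)) ('X - x%:P)) = 0 ->
  spread_frame E0 y *m D y = diag_mx p^T *m spread_frame E0 y.
Proof.
move=> ann; apply/row_matrixP => k.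
rewrite row_mul rowK row_diag_mul rowK [p^T 0 k]mxE.
apply/eqP; rewrite -subr_eq0 -mul_mx_scalar -mulmxBr; apply/eqP.
have -> : D y - (p k 0)%:M = horner_mx (D y) ('X - (p k 0)%:P).
  by rewrite rmorphB /= horner_mx_X horner_mx_C.
by rewrite -mulmxA mulmxE -rmorphM /= -other_rootsE ann mulmx0.
Qed.

(** At the base point each projection only rescales its eigenvector, by the value of [other_roots]
    at its own eigenvalue, which is nonzero. *)
Lemma spread_frame_unit E0 y : E0 \in unitmx -> E0 *m D y = diag_mx p^T *m E0 ->
  spread_frame E0 y \in unitmx.
Proof.
move=> E0u E0D.
have -> : spread_frame E0 y = diag_mx (\row_k (other_roots (p k 0)).[p k 0]) *m E0.
  apply/row_matrixP => k; rewrite rowK row_diag_mul mxE.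
  apply: horner_mx_eigen.
  by rewrite -row_mul E0D row_diag_mul mxE.
rewrite unitmx_mul E0u andbT unitmxE det_diag unitfE.
by apply/prodf_neq0 => k _; rewrite mxE.
Qed.

Section GramSchmidt.
Variables (U : set 'rV[R]_n).
Hypothesis oU : open U.
Hypothesis g_diff : twice_diff_mx U g.
Hypothesis g_sym : forall y, U y -> (g y)^T = g y.
Hypothesis g_pos : forall y, U y -> forall v : 'rV[R]_n, v != 0 -> 0 < (v *m g y *m v^T) 0 0.
Hypothesis Dg : forall y, U y -> D y *m g y = g y *m (D y)^T.

Definition eigenframe (X : 'rV[R]_n -> 'M[R]_n) :=
  [/\ twice_diff_mx U X, forall y, U y -> X y \in unitmx &
      forall y, U y -> X y *m D y = diag_mx p^T *m X y].

Definition gram (X : 'rV[R]_n -> 'M[R]_n) y : 'M[R]_n := X y *m g y *m (X y)^T.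

Lemma gram_diff X : eigenframe X -> twice_diff_mx U (gram X).
Proof.
move=> [hX _ _].
exact (twice_diff_mulmx oU (twice_diff_mulmx oU hX g_diff) (twice_diff_trmx hX)).
Qed.

Lemma gram_sym X y i j : U y -> gram X y i j = gram X y j i.
Proof.
move=> Uy; have -> : gram X y j i = (gram X y)^T i j by rewrite [RHS]mxE.
by rewrite /gram !trmx_mul trmxK g_sym// mulmxA.
Qed.

Lemma gram_gt0 X y k : eigenframe X -> U y -> 0 < gram X y k k.
Proof.
move=> [_ hX _] Uy.
have -> : gram X y k k = (row k (X y) *m g y *m (row k (X y))^T) 0 0.
  by rewrite /gram -row_mul tr_row !mxE; apply: eq_bigr => l _; rewrite !mxE.
apply: g_pos => //; rewrite rowE mulmx_free_eq0 ?row_free_unit ?hX//.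
by apply/eqP => /matrixP/(_ 0 k)/eqP; rewrite !mxE !eqxx oner_eq0.
Qed.

Lemma gram_eigen X y i j : eigenframe X -> U y ->
  p i 0 * gram X y i j = gram X y i j * p j 0.
Proof.
move=> [_ _ XD] Uy.
have : diag_mx p^T *m gram X y = gram X y *m diag_mx p^T.
  rewrite /gram !mulmxA -XD// -(mulmxA (X y)) Dg// -!mulmxA; congr (_ *m (_ *m _)).
  by rewrite -trmx_mul XD// trmx_mul tr_diag_mx.
move=> /matrixP/(_ i j); rewrite mul_diag_mx mul_mx_diag.
by rewrite [LHS]mxE [RHS]mxE ![p^T _ _]mxE.
Qed.

Definition gs_coef (k : 'I_n) X y : 'cV[R]_n :=
  \col_i (if i == k then 0 else gram X y i k / gram X y k k).

Definition gs_step (k : 'I_n) X y : 'M[R]_n := X y - gs_coef k X y *m row k (X y).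

Let gs_coefE k X y i : gs_coef k X y i 0 = if i == k then 0 else gram X y i k / gram X y k k.
Proof. by rewrite mxE. Qed.

Let gs_stepE k X y i : row i (gs_step k X y) = row i (X y) - gs_coef k X y i 0 *: row k (X y).
Proof. by apply/rowP => j; rewrite !mxE big_ord1 !mxE. Qed.

Lemma gs_coef_diff k X i : eigenframe X -> twice_diff U (fun y => gs_coef k X y i 0).
Proof.
move=> hX; case: (eqVneq i k) => [->|ik].
  apply: (@eq_twice_diff _ _ _ (fun=> 0)); last exact: twice_diff_cst.
  by move=> y; rewrite gs_coefE eqxx.
apply: (@eq_twice_diff _ _ _ (fun y => gram X y i k * (gram X y k k)^-1)).
  by move=> y; rewrite gs_coefE (negbTE ik).
have hg := gram_diff hX.
apply: (twice_diffM oU (hg i k)); apply: (twice_diffV oU _ (hg k k)) => y Uy.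
by rewrite gt_eqF// gram_gt0.
Qed.

(** Eigenvectors with distinct eigenvalues are g-orthogonal ([gram_eigen]), so a step only mixes
    rows with equal eigenvalues. It is invertible because the coefficient column vanishes at k: this
    makes [d *m c] zero, so that 1 + c d undoes the step. *)
Lemma gs_step_eigenframe k X : eigenframe X -> eigenframe (gs_step k X).
Proof.
move=> hX; have [Xd Xu XD] := hX; split.
- move=> i j; apply: (@eq_twice_diff _ _ _ (fun y => X y i j + (-1) * (gs_coef k X y i 0 * X y k j))).
    by move=> y; rewrite !mxE big_ord1 !mxE mulN1r.
  apply: (twice_diffD oU (Xd i j)).
  apply: (twice_diffM oU (@twice_diff_cst _ _ U _)).
  exact (twice_diffM oU (gs_coef_diff k i hX) (Xd k j)).
- move=> y Uy; have := Xu y Uy.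
  set c := gs_coef k X y; set d : 'rV[R]_n := delta_mx 0 k.
  have dc : d *m c = 0.
    by rewrite -rowE; apply/rowP => j; rewrite (ord1 j) mxE gs_coefE eqxx mxE.
  have -> : X y = (1%:M + c *m d) *m gs_step k X y.
    rewrite /gs_step -/c rowE -/d mulmxBr !mulmxDl !mul1mx.
    rewrite -(mulmxA c d (c *m _)) (mulmxA d c) dc mul0mx mulmx0 addr0 -mulmxA.
    by rewrite addrK.
  by rewrite unitmx_mul => /andP[].
- move=> y Uy; rewrite /gs_step mulmxBl mulmxBr XD//; congr (_ - _).
  rewrite -mulmxA -row_mul XD// row_diag_mul [p^T 0 k]mxE.
  rewrite -scalemxAr scalemxAl mulmxA; congr (_ *m _).
  apply/colP => i.
  have -> : (diag_mx p^T *m gs_coef k X y) i 0 = p i 0 * gs_coef k X y i 0.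
    by rewrite mul_diag_mx mxE [X in X * _]mxE.
  rewrite [LHS]mxE !gs_coefE.
  case: eqP => [->|_]; first by rewrite !mulr0.
  by rewrite [RHS]mulrA (gram_eigen i k hX Uy) mulrCA mulrA.
Qed.

Let gramE X y i j : gram X y i j = (row i (X y) *m g y *m (row j (X y))^T) 0 0.
Proof. by rewrite /gram -row_mul tr_row !mxE; apply: eq_bigr => l _; rewrite !mxE. Qed.

Let bilinear_sub (u v w : 'rV[R]_n) (G : 'M[R]_n) (a c : R) :
  ((u - a *: w) *m G *m (v - c *: w)^T) 0 0 =
  (u *m G *m v^T) 0 0 - c * (u *m G *m w^T) 0 0
  - a * (w *m G *m v^T) 0 0 + a * c * (w *m G *m w^T) 0 0.
Proof.
have -> : (v - c *: w)^T = v^T - c *: w^T by apply/matrixP => i j; rewrite !mxE.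
rewrite mulmxBr -scalemxAr !mulmxBl -!scalemxAl.
move: (u *m G *m v^T) (u *m G *m w^T) (w *m G *m v^T) (w *m G *m w^T) => A B C E.
by rewrite !mxE; ring.
Qed.

Lemma gram_gs_step k X y i j : gram (gs_step k X) y i j =
  gram X y i j - gs_coef k X y j 0 * gram X y i k - gs_coef k X y i 0 * gram X y k j
  + gs_coef k X y i 0 * gs_coef k X y j 0 * gram X y k k.
Proof. by rewrite gramE !gs_stepE bilinear_sub -!gramE. Qed.

Lemma orthogonal_eigenframe X0 : eigenframe X0 -> exists2 X, eigenframe X &
  forall y, U y -> forall i j, i != j -> gram X y i j = 0.
Proof.
move=> hX0.
(* The invariant makes each row of index below [m] orthogonal to every other row, later ones
   included. Such rows have coefficient zero along the next pivot, so the next step leaves them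
   alone. *)
suff h m : (m <= n)%N -> exists2 X, eigenframe X & forall y, U y -> forall i j : 'I_n,
    i != j -> ((i < m) || (j < m))%N -> gram X y i j = 0.
  have [X hX Xo] := h n (leqnn n); exists X => // y Uy i j ij.
  by apply: Xo => //; rewrite ltn_ord.
elim: m => [|m IH] mn; first by exists X0.
have [X hX Xo] := IH (ltnW mn).
pose k := Ordinal mn; exists (gs_step k X); first exact: gs_step_eigenframe.
move=> y Uy i j ij ijm; rewrite gram_gs_step !gs_coefE.
have hkk : gram X y k k != 0 by rewrite gt_eqF// gram_gt0.
case: (eqVneq i k) => [ik|ik].
  rewrite ik eq_sym in ij *; rewrite (negbTE ij) (gram_sym X j k Uy).
  by field.
case: (eqVneq j k) => [jk|jk]; first by rewrite jk; field.
have ltk (a : 'I_n) : a != k -> (a < m.+1)%N = (a < m)%N.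
  by move=> ak; rewrite ltnS leq_eqVlt; case: eqP => // e; case/eqP: ak; exact: val_inj.
rewrite !ltk// in ijm; rewrite (Xo y Uy i j)//.
case/orP: ijm => im.
  by rewrite (Xo y Uy i k)// ?im// !(mul0r, mulr0) !subr0 addr0.
by rewrite (Xo y Uy j k)// ?im// (Xo y Uy k j) 1?eq_sym ?im ?orbT// !(mul0r, mulr0) !subr0 addr0.
Qed.

Lemma orthonormal_eigenframe X0 : eigenframe X0 -> exists2 E, eigenframe E &
  forall y, U y -> E y *m g y *m (E y)^T = 1%:M.
Proof.
move=> /orthogonal_eigenframe[X hX Xo]; have [Xd Xu XD] := hX.
pose s y : 'rV[R]_n := \row_k (Num.sqrt (gram X y k k))^-1.
have s0 y k : U y -> 0 < s y 0 k by move=> Uy; rewrite mxE invr_gt0 sqrtr_gt0 gram_gt0.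
exists (fun y => diag_mx (s y) *m X y).
  split.
  - move=> i j; apply: (@eq_twice_diff _ _ _ (fun y => (Num.sqrt (gram X y i i))^-1 * X y i j)).
      by move=> y; rewrite mul_diag_mx !mxE.
    apply: (twice_diffM oU _ (Xd i j)).
    have hg := gram_diff hX.
    apply: (twice_diffV oU _ (twice_diff_sqrt oU _ (hg i i))) => y Uy.
      by rewrite gt_eqF// sqrtr_gt0 gram_gt0.
    exact: gram_gt0.
  - move=> y Uy; rewrite unitmx_mul Xu// andbT unitmxE det_diag unitfE.
    by apply/prodf_neq0 => k _; rewrite gt_eqF// s0.
  - move=> y Uy; rewrite -mulmxA XD// !mulmxA; congr (_ *m _).
    by rewrite !mulmx_diag; congr diag_mx; apply/rowP => k; rewrite !mxE mulrC.
move=> y Uy.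
have -> : diag_mx (s y) *m X y *m g y *m (diag_mx (s y) *m X y)^T =
    diag_mx (s y) *m gram X y *m diag_mx (s y).
  by rewrite trmx_mul tr_diag_mx /gram !mulmxA.
have e i j : (diag_mx (s y) *m gram X y *m diag_mx (s y)) i j =
    s y 0 i * gram X y i j * s y 0 j.
  by rewrite mul_mx_diag [LHS]mxE mul_diag_mx [X in X * _]mxE.
apply/matrixP => i j; rewrite e [RHS]mxE.
case: (eqVneq i j) => [->|ij]; last by rewrite Xo// mulr0 mul0r.
have h0 := ltW (gram_gt0 j hX Uy).
have -> : s y 0 j = (Num.sqrt (gram X y j j))^-1 by rewrite [LHS]mxE.
rewrite -[X in _ * X * _](sqr_sqrtr h0) /= mulr1n; field.
by rewrite gt_eqF// sqrtr_gt0 gram_gt0.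
Qed.
End GramSchmidt.
End EigenFrame.

(** * The exponential of a diagonalizable matrix *)

Section MatrixExponential.
Context {R : realType}.

Lemma cvg_sum_scale (V : normedModType R) (I : finType) (s : I -> nat -> R) (l : I -> R)
    (C : I -> V) : (forall i, s i @ \oo --> l i) ->
  (fun m => \sum_i s i m *: C i) @ \oo --> \sum_i l i *: C i.
Proof.
move=> sl; elim: (index_enum I) => [|i r IH].
  rewrite big_nil (_ : (fun _ => _) = cst 0); first exact: cvg_cst.
  by apply/funext => m; rewrite big_nil.
rewrite big_cons (_ : (fun _ => _) = (fun m => s i m *: C i) \+ (fun m => \sum_(j <- r) s j m *: C j)).
  by apply: cvgD => //; exact: cvgZr_tmp.
by apply/funext => m; rewrite big_cons.
Qed.

(** In the eigenframe the matrix series is a finite combination of fixed rank-one matrices with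
    scalar exponential series as coefficients, so convergence and limit are those of the scalar
    series. *)
Lemma expmx_eigen n (A E th : 'M[R]_n) (d : 'rV[R]_n) (u : R) :
  E *m th = 1%:M -> E *m A = diag_mx d *m E ->
  expmx (u *: A) = th *m diag_mx (\row_k expR (u * d 0 k)) *m E.
Proof.
move=> Eth EA; have thE := mulmx1C Eth.
have A_pow k : (u *: A) ^+ k = th *m diag_mx (\row_i (u * d 0 i) ^+ k) *m E.
  elim: k => [|k IH].
    rewrite expr0 (_ : diag_mx _ = 1%:M) ?mulmx1 ?thE//.
    by apply/matrixP => i j; rewrite !mxE expr0.
  have -> : (u *: A) ^+ k.+1 = (u *: A) ^+ k *m (u *: A) by rewrite exprSr.
  rewrite IH -scalemxAr -(mulmxA _ E A) EA mulmxA -(mulmxA th) mulmx_diag.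
  rewrite scalemxAl scalemxAr; congr (_ *m _ *m _).
  by apply/matrixP => i j; rewrite !mxE exprSr; case: eqP => _; rewrite ?mulr1n ?mulr0n ?mulr0//; ring.
have decomp (e : 'rV[R]_n) : th *m diag_mx e *m E = \sum_i e 0 i *: (col i th *m row i E).
  apply/matrixP => a b; rewrite summxE mul_mx_diag mxE; apply: eq_bigr => i _.
  by rewrite !mxE big_ord1 !mxE; ring.
rewrite decomp; apply/cvg_lim; first exact: norm_hausdorff.
have -> : series (fun k : nat => (k`!%:R : R)^-1 *: (u *: A) ^+ k) =
    (fun m => \sum_i series (exp_coeff (u * d 0 i)) m *: (col i th *m row i E)).
  apply/funext => m; rewrite /series /=.
  under eq_bigr do rewrite A_pow decomp scaler_sumr.
  rewrite exchange_big /=; apply: eq_bigr => i _.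
  rewrite scaler_suml; apply: eq_bigr => k _.
  by rewrite scalerA mxE /exp_coeff /= mulrC.
under eq_bigr do rewrite mxE.
apply: cvg_sum_scale => i; exact: is_cvg_series_exp_coeff.
Qed.

End MatrixExponential.

(** * From the Einstein equation to the resonance identity *)

Section EinsteinExtension.
Context {R : realType}.

(** Since p is the same at all points, one polynomial annihilates D throughout. The eigenbasis at
    [y0] therefore spreads to eigenvectors everywhere, which form a frame on the open set where
    their determinant is nonzero; Gram-Schmidt then applies. *)
Lemma local_eigenframe n' (D g : 'rV[R]_n'.+1 -> 'M[R]_n'.+1) (p : 'cV[R]_n'.+1)
    (U0 : set 'rV[R]_n'.+1) y0 :
  open U0 -> U0 y0 -> smooth_mx_on U0 D -> smooth_mx_on U0 g ->
  (forall y, U0 y -> (g y)^T = g y) ->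
  (forall y, U0 y -> forall v : 'rV[R]_n'.+1, v != 0 -> 0 < (v *m g y *m v^T) 0 0) ->
  (forall y, U0 y -> D y *m g y = g y *m (D y)^T) ->
  (forall y, U0 y -> char_poly (D y) = \prod_(k < n'.+1) ('X - (p k 0)%:P)) ->
  exists U E, [/\ open U, U y0, U `<=` U0, eigenframe D p U E &
    twice_diff_mx U g /\ forall y, U y -> E y *m g y *m (E y)^T = 1%:M].
Proof.
move=> oU0 U0y0 sD sg gsym gpos Dg spec.
have tD : twice_diff_mx U0 D by move=> i j; exact/smooth_twice_diff/sD.
have tg : twice_diff_mx U0 g by move=> i j; exact/smooth_twice_diff/sg.
have [E0 E0u E0D] := symmetric_eigenbasis (gpos _ U0y0) (Dg _ U0y0) (spec _ U0y0).
pose X := spread_frame D p E0.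
have tX : twice_diff_mx U0 X := twice_diff_spread_frame p E0 oU0 tD.
pose U := [set y | U0 y /\ \det (X y) != 0].
have UU0 : U `<=` U0 by move=> y [].
have oU : open U.
  rewrite openE => y [U0y dy].
  have [dX _] := twice_diff_det oU0 tX U0y.
  have near0 : \forall z \near y, U0 z by exact: open_nbhs_nbhs.
  have near1 : \forall z \near y, \det (X z) != 0.
    exact: (cvgr_neq0 _ (differentiable_continuous dX)).
  exact: (filterI near0 near1).
have Uy0 : U y0.
  split=> //; have := spread_frame_unit E0u E0D.
  by rewrite unitmxE unitfE.
have sub m k (M : 'rV[R]_n'.+1 -> 'M[R]_(m, k)) : twice_diff_mx U0 M -> twice_diff_mx U M.
  by move=> hM i j y Uy; apply: hM; exact: UU0.
have hX : eigenframe D p U X.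
  split; first exact: sub.
    by move=> y [_]; rewrite unitmxE unitfE.
  move=> y /UU0 Uy; apply: spread_frame_eigen.
  exact: (spectrum_annihilator (gpos _ Uy) (Dg _ Uy) (spec _ Uy)).
have [E hE Eo] := orthonormal_eigenframe oU (sub _ _ _ tg) (fun y Uy => gsym y (UU0 y Uy))
  (fun y Uy => gpos y (UU0 y Uy)) (fun y Uy => Dg y (UU0 y Uy)) hX.
by exists U, E; split => //; split => //; exact: sub.
Qed.

Section Coordinates.
Variables (n' : nat) (D g : 'rV[R]_n'.+1 -> 'M[R]_n'.+1) (p : 'cV[R]_n'.+1).
Local Notation n := n'.+1.
Variables (U : set 'rV[R]_n) (E : 'rV[R]_n -> 'M[R]_n) (y0 : 'rV[R]_n).
Hypotheses (oU : open U) (Uy0 : U y0) (hE : eigenframe D p U E).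
Hypothesis g_diff : twice_diff_mx U g.
Hypothesis E_orth : forall y, U y -> E y *m g y *m (E y)^T = 1%:M.

(** Orthonormality of [E] makes this its inverse, and in this form its regularity is immediate. *)
Definition coframe y : 'M[R]_n := g y *m (E y)^T.

Let Eth y : U y -> E y *m coframe y = 1%:M.
Proof. by move=> Uy; rewrite /coframe mulmxA E_orth. Qed.

Let thE y : U y -> coframe y *m E y = 1%:M.
Proof. by move=> Uy; exact/mulmx1C/Eth. Qed.

Let th_diff : twice_diff_mx U coframe.
Proof. by case: hE => hE' _ _; exact (twice_diff_mulmx oU g_diff (twice_diff_trmx hE')). Qed.

Let D_frame y : U y -> D y = coframe y *m diag_mx p^T *m E y.
Proof.
by case: hE => _ _ ED Uy; rewrite -mulmxA -ED// mulmxA thE// mul1mx.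
Qed.

Lemma det_eigenframe : \det (D y0) != 0 -> forall a, p a 0 != 0.
Proof.
rewrite D_frame// !det_mulmx det_diag !mulf_eq0 !negb_or.
by move=> /andP[/andP[_ /prodf_neq0 h] _] a; have := h a isT; rewrite mxE.
Qed.

Lemma trace_eigenframe : \tr (D y0) = \sum_a p a 0.
Proof.
rewrite D_frame// mxtrace_mulC mulmxA Eth// mul1mx mxtrace_diag.
by apply: eq_bigr => a _; rewrite mxE.
Qed.

Variable G : 'rV[R]_(1 + n) -> 'M[R]_(1 + n).
Hypothesis G_def : forall v, U (rsubmx v) -> G v = block_mx 1%:M 0 0
  (expmx (lsubmx v 0 0 *: D (rsubmx v)) *m g (rsubmx v)
     *m (expmx (lsubmx v 0 0 *: D (rsubmx v)))^T).

Let conj_diag (t A h : 'M[R]_n) (d : 'rV[R]_n) : A *m h *m A^T = 1%:M ->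
  t *m diag_mx d *m A *m h *m (t *m diag_mx d *m A)^T =
  t *m diag_mx (\row_k (d 0 k * d 0 k)) *m t^T.
Proof.
move=> Ah; rewrite !trmx_mul tr_diag_mx.
transitivity (t *m diag_mx d *m (A *m h *m A^T) *m diag_mx d *m t^T).
  by rewrite !mulmxA.
by rewrite Ah mulmx1 -(mulmxA t) mulmx_diag.
Qed.

Lemma extension_metric v : U (rsubmx v) -> G v = block_mx 1%:M 0 0
  (coframe (rsubmx v) *m diag_mx (\row_a weight p a v) *m (coframe (rsubmx v))^T).
Proof.
move=> Uv; rewrite G_def//; congr block_mx; have [_ _ ED] := hE.
set y := rsubmx v in Uv *; set u := lsubmx v 0 0.
rewrite (expmx_eigen u (Eth Uv) (ED y Uv)).
set e := \row_k _.
rewrite (conj_diag _ _ (E_orth Uv)); congr (_ *m diag_mx _ *m _).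
apply/rowP => k; rewrite !mxE -expRD /weight; congr expR; rewrite /u; ring.
Qed.

(** The (d_u, d_u) component fixes the Einstein constant; the (E_q, E_q) components then supply the
    hypothesis of [weight_zero_part]. The coefficients are quarters of squared structure constants
    at [y0]. *)
Lemma einstein_resonance (c : R) :
  (forall a, p a 0 != 0) ->
  (forall v, U (rsubmx v) -> ricci G v = c *: G v) ->
  exists2 mu : 'I_n * 'I_n * 'I_n -> R, forall x, 0 <= mu x &
    (\sum_a p a 0 ^+ 2) *: ones R n - (\sum_a p a 0) *: p =
      \sum_(x in resonances p) mu x *: Fvec x.
Proof.
move=> p0 ein; have [tE _ _] := hE.
have dE := twice_diff_mx_derivable tE.
have dth := twice_diff_mx_derivable th_diff.
have ddth := twice_diff_mx_derivable2 oU th_diff.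
have GE v (Uv : U (rsubmx v)) i : (extend_mx 1 E v *m ricci G v *m (extend_mx 1 E v)^T) i i =
    c * frame_weights p v 0 i.
  rewrite ein// -scalemxAr -scalemxAl (frame_metric_extension Eth extension_metric Uv).
  by rewrite !mxE eqxx mulr1n.
(* The whole line over the fixed point [y0]: along it the structure constants and their derivatives
   do not change, and only the weights depend on u. *)
pose pt (u : R) : 'rV[R]_(1 + n) := row_mx u%:M y0.
have rpt u : rsubmx (pt u) = y0 by rewrite row_mxKr.
have lpt u : lsubmx (pt u) 0 0 = u by rewrite row_mxKl mxE eqxx mulr1n.
have Upt u : U (rsubmx (pt u)) by rewrite rpt.
have cE : c = - \sum_a p a 0 ^+ 2.
  rewrite -(ricci_extension_l oU Eth dE dth ddth extension_metric (Upt 0)) GE//.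
  by rewrite row_mxEl mxE mulr1.
pose t c a d := frame_torsion E coframe c a d y0.
have t_anti a b d : t a b d = - t b a d by rewrite /t /frame_torsion opprB.
exists (fun x => 4^-1 * t x.1.1 x.1.2 x.2 ^+ 2).
  by move=> x; rewrite mulr_ge0 ?sqr_ge0// invr_ge0 ler0n.
apply: resonance_combination => // q; rewrite -cE.
apply: (weight_zero_part p0 t_anti (fl := flat_ricci E coframe q y0)
  (X := fun a => frame_derive E a (frame_torsion E coframe q a q) y0)
  (Y := fun a => frame_derive E q (frame_torsion E coframe q a a) y0)) => u w wE.
have wpt : (fun a => weight p a (pt u)) = w.
  by apply/funext => a; rewrite /weight lpt wE.
have := ricci_extension_r oU Eth dE dth ddth extension_metric q (Upt u) (rpt u) wpt.
rewrite (GE _ (Upt u)).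
have -> : frame_weights p (pt u) 0 (rshift 1 q) = w q by rewrite row_mxEr mxE -wpt.
exact id.
Qed.

End Coordinates.

Lemma cimage_product_chart (T : topologicalType) n (c : chart R T n) (v : 'rV[R]_(1 + n)) :
  cimage c (rsubmx v) -> cimage (product_chart c) v.
Proof.
move=> [x cx xv]; exists (lsubmx v 0 0, x) => //=.
rewrite xv; apply/rowP => j; rewrite -[v in RHS]hsubmxK.
case: (split_ordP j) => [k ->|k ->]; rewrite ?row_mxEr// !row_mxEl.
by rewrite (ord1 k) mxE eqxx mulr1n.
Qed.

(** The conclusion involves p alone, and [is_spectral_vector] gives the same p at every point, so
    one chart around one point of N suffices. *)
Lemma einstein_extension_resonance n' (N : riemannian_data R n'.+1)
    (D : chart_index N -> 'rV[R]_n'.+1 -> 'M[R]_n'.+1) (p : 'cV[R]_n'.+1) :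
  is_riemannian_manifold N -> is_connected N -> is_symmetric_endo_field D ->
  is_einstein (D_extension D) -> det_nonzero D -> is_spectral_vector D p ->
  [/\ forall a, p a 0 != 0, trace_nonzero D -> \sum_a p a 0 != 0 &
    exists2 mu : 'I_n'.+1 * 'I_n'.+1 * 'I_n'.+1 -> R, forall x, 0 <= mu x &
      (\sum_a p a 0 ^+ 2) *: ones R n'.+1 - (\sum_a p a 0) *: p =
        \sum_(x in resonances p) mu x *: Fvec x].
Proof.
move=> [_ _ [charts cover _] [sg _ gsym gpos]] [[x0 _] _] [sD _ Dg] [c ein] detD spec.
have [i ix0] := cover x0.
have [_ oU0 _ _ _] := charts i.
pose y0 := Defs.coord (atlas i) x0.
have U0y0 : cimage (atlas i) y0 by exists x0.
have [U [E [oU Uy0 UU0 hE [tg Eo]]]] := local_eigenframe oU0 U0y0 (sD i) (sg i)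
  (gsym i) (gpos i) (Dg i) (spec i).
have p0 := det_eigenframe Uy0 hE Eo (detD i y0 U0y0).
split => //.
  by move=> /(_ i y0 U0y0); rewrite (trace_eigenframe Uy0 hE Eo).
have GE v : U (rsubmx v) -> @metric R _ (D_extension D) i v = block_mx 1%:M 0 0
    (expmx (lsubmx v 0 0 *: D i (rsubmx v)) *m metric i (rsubmx v)
       *m (expmx (lsubmx v 0 0 *: D i (rsubmx v)))^T) by [].
refine (einstein_resonance oU Uy0 hE tg Eo GE (c := c) p0 _).
by move=> v /UU0 Uv; apply: ein; exact: cimage_product_chart.
Qed.

End EinsteinExtension.

(** * Projection, normal form, integrality and finiteness *)

Theorem theorem2 (R : realType) :
  (forall (n : nat) (N : riemannian_data R n)
          (D : chart_index N -> 'rV[R]_n -> 'M[R]_n) (p : 'cV[R]_n),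
     (1 < n)%N ->
     is_riemannian_manifold N -> is_connected N ->
     is_symmetric_endo_field D ->
     is_einstein (D_extension D) ->
     det_nonzero D ->
     is_spectral_vector D p ->
     (* (i) *)
     (exists2 w : 'cV[R]_n,
        is_orthogonal_projection (perp p) (ones R n) w &
        cone_hull (@Fset R n `&` perp p) w) /\
     (* (ii) *)
     (trace_nonzero D ->
        (forall (m : nat) (V : 'M[R]_(n, m)),
           maximal_independent_columns_in (@Fset R n `&` perp p) V ->
           exists2 c : R, c != 0 &
             p = c *: (ones R n - V *m invmx (V^T *m V) *m ones R m)) /\
        (exists2 c : R, c != 0 & forall k : 'I_n, c * p k 0 \is a Num.int))) /\
  (* finitely many eigenvalue types in each dimension, up to scaling *)
  (forall n : nat,
     exists S : seq 'cV[R]_n,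
       forall (N : riemannian_data R n)
              (D : chart_index N -> 'rV[R]_n -> 'M[R]_n) (p : 'cV[R]_n),
         is_riemannian_manifold N -> is_connected N ->
         is_symmetric_endo_field D ->
         is_einstein (D_extension D) ->
         det_nonzero D -> trace_nonzero D ->
         is_spectral_vector D p ->
         exists2 q : 'cV[R]_n, q \in S &
           exists2 c : R, c != 0 & p = c *: q).
Proof.
have sq_neq0 n' (p : 'cV[R]_n'.+1) : (forall a, p a 0 != 0) -> \sum_a p a 0 ^+ 2 != 0.
  move=> p0; rewrite psumr_neq0 => [|a _]; last exact: sqr_ge0.
  by apply/hasP; exists ord0; rewrite ?mem_index_enum// lt_def sqrf_eq0 p0 sqr_ge0.
have resonance_normal_form n' (p : 'cV[R]_n'.+1) (mu : _ -> R) (s T : R) : T != 0 ->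
    s *: ones R n'.+1 - T *: p = \sum_(x in resonances p) mu x *: Fvec x ->
    p = (s / T) *: normal_form (resonance_basis (resonances p)).
  move=> T0; apply: spectral_normal_form => //; first exact: resonance_basis_free.
    move=> j; have [x xB ->] := col_resonance_basis j; exact: Fvec_resonance.
  by move=> x; exact: resonance_basis_span.
split=> [n N D p|n].
  case: n N D p => // n' N D p _ rN cN sD eN dN sp.
  have [p0 T0 [mu mu0 muE]] := einstein_extension_resonance rN cN sD eN dN sp.
  set s := \sum_a p a 0 ^+ 2 in muE; set T := \sum_a p a 0 in T0 muE.
  have s0 : s != 0 by exact: sq_neq0.
  split.
    (* T is the inner product of 1_n with p and s is |p|^2, so this is the usual formula for the
       projection to a hyperplane. *)
    exists (ones R n'.+1 - (T / s) *: p).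
      split.
        rewrite /perp /= dotDl dotNl dotZl !dotE.
        have -> : \sum_i p i 0 * p i 0 = s by apply: eq_bigr => i _; rewrite expr2.
        have -> : \sum_i ones R n'.+1 i 0 * p i 0 = T.
          by apply: eq_bigr => i _; rewrite mxE mul1r.
        by rewrite divfK// subrr.
      move=> u; rewrite /perp /= opprB addrCA subrr addr0 dotZl !dotE => up.
      rewrite (_ : \sum_i p i 0 * u i 0 = 0) ?mulr0// -[RHS]up.
      by apply: eq_bigr => i _; rewrite mulrC.
    (* The resonance identity divided by s, which is positive, so the coefficients stay
       nonnegative. *)
    exists #|resonances p|, (fun l => Fvec (enum_val l)), (fun l => s^-1 * mu (enum_val l)); split.
    - by move=> l; apply: Fvec_resonance; exact: enum_valP.
    - by move=> l; rewrite mulr_ge0// invr_ge0 sumr_ge0// => a _; exact: sqr_ge0.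
    - have := congr1 (fun v => s^-1 *: v) muE.
      rewrite scalerBr !scalerA mulVf// scale1r mulrC => ->.
      rewrite scaler_sumr big_enum_val.
      by apply: eq_bigr => l _; rewrite scalerA.
  move=> /T0 {}T0; split.
    move=> m V maxV; exists (s / T); first by rewrite mulf_neq0// invr_eq0.
    have [[Vin Vfree] _] := maxV.
    exact: (spectral_normal_form T0 Vfree Vin (maximal_span maxV) muE).
  have pE := resonance_normal_form _ _ _ _ _ T0 muE.
  have [c c0 cint] := normal_form_int (resonance_basis_free (resonances p))
    (@resonance_basis_int R _ (resonances p)).
  (* The factor T / s undoes the scaling s / T between p and its normal form; [c] then clears the
     denominators. *)
  exists (c * (T / s)); first by rewrite !mulf_neq0// invr_eq0.
  move=> k; rewrite [in X in _ * X]pE mxE mulrA.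
  have -> : c * (T / s) * (s / T) = c by field; rewrite s0 T0.
  exact: cint.
(* One candidate for each set of index triples, whether or not it is the resonance set of some
   spectral vector. *)
exists [seq normal_form (resonance_basis B) | B <- enum {set 'I_n * 'I_n * 'I_n}].
move=> N D p; case: n N D p => [|n'] N D p rN cN sD eN dN tN sp.
  (* In dimension 0 the trace is an empty sum, which contradicts [trace_nonzero] at any point. *)
  exfalso; have [_ _ [_ cover _] _] := rN; have [[x0 _] _] := cN.
  have [i ix0] := cover x0.
  have := tN i (Defs.coord (atlas i) x0) (ex_intro2 _ _ x0 ix0 erefl).
  by rewrite /mxtrace big_ord0 eqxx.
have [p0 /(_ tN) T0 [mu mu0 muE]] := einstein_extension_resonance rN cN sD eN dN sp.
exists (normal_form (resonance_basis (resonances p))).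
  by apply/mapP; exists (resonances p); rewrite ?mem_enum.
eexists; last exact: resonance_normal_form T0 muE.
by rewrite mulf_neq0 ?invr_eq0// sq_neq0.
Qed.
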